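(* Let $G$ be a $t$-tough graph on $n$ vertices with $t=\omega(\log^3 n)$. Then $G$ contains a cycle of length $(1-o(1))n$.
   Context: All graphs are finite and simple. A graph $G$ is $t$-tough if for every $S\subseteq V(G)$ such that $G-S$ has $k\geq 2$ connected components, $|S|\geq tk$ (so complete graphs are $t$-tough for every $t$). Asymptotic notation is with respect to $n\to\infty$: $t=\omega(\log^3 n)$ means $t/(\log n)^3\to\infty$. The conclusion means: for every $\delta>0$ and all sufficiently large $n$ (depending only on $\delta$ and on the rate of divergence in the hypothesis), $G$ contains a cycle of length at least $(1-\delta)n$. *)

(* Defs.v *)
From mathcomp Require Import all_boot all_order all_algebra.
From mathcomp Require Import all_classical all_reals all_analysis.

Set Implicit Arguments.
Unset Strict Implicit.
Unset Printing Implicit Defensive.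

Import Order.TTheory GRing.Theory Num.Theory.
Import numFieldNormedType.Exports.

Local Open Scope ring_scope.

(* A finite simple graph is given by its vertex type and adjacency relation. *)
Definition simple_graph (V : finType) (e : rel V) : Prop :=
  symmetric e /\ irreflexive e.

Definition graph_del (V : finType) (e : rel V) (S : {set V}) : rel V :=
  [rel x y | [&& e x y, x \notin S & y \notin S]].

(* In [graph_del e S] the vertices of S are kept as isolated points of the
   type V, so the count is restricted to the complement of S. *)
Definition num_components_del (V : finType) (e : rel V) (S : {set V}) : nat :=
  n_comp (graph_del e S) (~: S).

Definition tough (R : realType) (t : R) (V : finType) (e : rel V) : Prop :=
  forall S : {set V}, (2 <= num_components_del e S)%N ->
    t * (num_components_del e S)%:R <= #|S|%:R.

(* [c] lists the vertices of a cycle in cyclic order, so [size c] is its length;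
   the size condition excludes the degenerate [ucycle]s (the empty sequence and
   an edge traversed back and forth). *)
Definition graph_cycle (V : finType) (e : rel V) (c : seq V) : Prop :=
  ucycle e c /\ (3 <= size c)%N.

(* Main.v *)
Require Import Defs.
From mathcomp Require Import all_boot zify.
From mathcomp Require all_order all_algebra all_classical all_reals all_analysis.

Set Implicit Arguments.
Unset Strict Implicit.
Unset Printing Implicit Defensive.

(** Cover almost all of the graph by long vertex-disjoint paths and merge these
    in O(log n) rounds, reducing their number by a constant factor each time.
    Every round costs a fraction of about 1/log n of the vertices, and runs
    through its own small random reserve of vertices, of density about
    1/log n, fixed in advance.

    The paths come for free.  In a path partition with as few paths as possible
    the first vertices are pairwise non-adjacent, and a T-tough graph has no
    independent set of more than n/T vertices ([path_cover]).  The few vertices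
    on paths much shorter than T are discarded.

    In a round with paths P_1, ..., P_m let X_a be an initial segment of P_a, of
    length |P_a|/K with K of order log n.  If an X_a and an X_b are joined by a
    path through the reserve R, then P_a and P_b merge into one path at the cost
    of the vertices before the junctions ([merge_round]).  Many disjoint
    junctions exist by a weak form of Gallai's theorem on disjoint paths between
    terminals ([packing]): either there are many, or a small set S of hubs
    separates most of the terminals from each other.  The second case is excluded
    when deleting any set S from the reserve leaves at most max(1, |S|) relevant
    components, which is the predicate [linked].

    The heart of the matter is that a random reserve is [linked] as soon as
    T p^2 exceeds a large multiple of log n, where p = 1/#|C| is its density.
    The reserve is R1 :|: R2 for two colour classes of a random colouring.  First,
    R1 is dominating in a robust sense: after deletion of S, few vertices lose
    all their neighbours in R1 ([trapped_rare]).  Then consider a way of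
    grouping the components of R1 :\: S into k > |S| groups.  By toughness, about
    T k disjoint connectors (single vertices or edges outside R1) join different
    groups, and each of them lies in R2 with probability p^2 or more; so the
    grouping survives with probability at most exp(- c T p^2 k).  There are too
    many groupings for a crude union bound, but few with a small number of
    connectors: the contraction argument of Karger for small cuts applies
    ([few_cuts]).  The resulting union bound over S and over the groupings, for
    all colour classes at once, is [good_colouring].

    Since p is of order 1/log n, the condition on T is that it be a large multiple
    of (log n)^3, and the same order is what makes |X_a| exceed the number of
    trapped vertices per element of S.  Everything up to [long_cycle] is done
    with natural numbers: n < 2 ^ l, and probabilities are ratios of cardinals
    bounded by powers of 2 ^ l. *)

(** * Families of sets *)

Lemma card_bigcup_le (T I : finType) (P : pred I) (F : I -> {set T}) :
  #|\bigcup_(i | P i) F i| <= \sum_(i | P i) #|F i|.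
Proof.
elim/big_rec2: _ => [|i n U _ leUn]; first by rewrite cards0.
by rewrite (leq_trans (leq_card_setU _ _)) ?leq_add2l.
Qed.

Lemma trivIset_eq (T : finType) (P : {set {set T}}) (B B' : {set T}) z :
  trivIset P -> B \in P -> B' \in P -> z \in B -> z \in B' -> B = B'.
Proof.
move=> tP BP BP' zB zB'; apply/eqP; apply: contraT => BB'.
by have /trivIsetP/(_ B B' BP BP' BB')/pred0P/(_ z) := tP; rewrite /= zB zB'.
Qed.

(** * Connected sets and disjoint connected blocks between terminals *)

Section Connected.
Variables (V : finType) (e : rel V).
Hypothesis e_sym : symmetric e.

Definition within (Q : {set V}) : rel V :=
  [rel x y | [&& e x y, x \in Q & y \in Q]].

Definition conn (Q : {set V}) : bool :=
  [forall x in Q, forall y in Q, connect (within Q) x y].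

Lemma connP (Q : {set V}) : reflect {in Q &, forall x y, connect (within Q) x y} (conn Q).
Proof.
apply: (iffP idP) => [/forall_inP H x y xQ yQ | H].
  by have /forall_inP := H x xQ; apply.
by apply/forall_inP => x xQ; apply/forall_inP => y yQ; apply: H.
Qed.

Lemma within_sym (Q : {set V}) : symmetric (within Q).
Proof. by move=> x y; rewrite /within /= (e_sym x y) [(x \in Q) && _]andbC. Qed.

Lemma connect_within_sym (Q : {set V}) : connect_sym (within Q).
Proof. exact/sym_connect_sym/within_sym. Qed.

Lemma connect_withinS (A B : {set V}) x y :
  A \subset B -> connect (within A) x y -> connect (within B) x y.
Proof.
move=> /subsetP AB; apply: connect_sub => u v /and3P[uv uA vA].
by apply: connect1; rewrite /within /= uv !AB.
Qed.

Lemma conn1 x : conn [set x].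
Proof. by apply/connP => y z /set1P-> /set1P->; apply: connect0. Qed.

Lemma conn0 : conn set0.
Proof. by apply/connP => y z; rewrite inE. Qed.

Lemma conn_join (A B : {set V}) x y : conn A -> conn B ->
  x \in A -> y \in B -> (x == y) || e x y -> conn (A :|: B).
Proof.
move=> /connP cA /connP cB xA yB xy; set U := A :|: B.
have AU : A \subset U by apply: subsetUl.
have BU : B \subset U by apply: subsetUr.
have cxy : connect (within U) x y.
  case/orP: xy => [/eqP->|xy]; first exact: connect0.
  by apply: connect1; rewrite /within /= xy (subsetP AU) // (subsetP BU).
have toX z : z \in U -> connect (within U) x z.
  case/setUP => zU; first exact/(connect_withinS AU)/cA.
  by apply: connect_trans cxy _; apply/(connect_withinS BU)/cB.
apply/connP => u v uU vU; apply: connect_trans (toX v vU).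
by rewrite connect_within_sym; apply: toX.
Qed.

Lemma conn_path x p : path e x p -> conn [set z in x :: p].
Proof.
elim: p x => [|y p IH] x /=.
  move=> _; suff -> : [set z in [:: x]] = [set x] by apply: conn1.
  by apply/setP => z; rewrite !inE.
case/andP => xy /IH cp.
have -> : [set z in [:: x, y & p]] = [set x] :|: [set z in y :: p].
  by apply/setP => z; rewrite !inE.
apply: (@conn_join _ _ x y) => //; rewrite ?conn1 ?inE ?eqxx ?xy ?orbT //.
Qed.

Lemma conn_sorted s : sorted e s -> conn [set z in s].
Proof.
case: s => [_|x p]; last exact: conn_path.
suff -> : [set z in [::]] = set0 :> {set V} by apply: conn0.
by apply/setP => z; rewrite !inE.
Qed.

Lemma within_path (Q : {set V}) x p : path (within Q) x p -> path e x p /\ all (mem Q) p.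
Proof.
elim: p x => //= y p IH x /andP[/and3P[xy _ yQ] /IH[-> ->]].
by rewrite xy yQ.
Qed.

Lemma conn_spath (Q : {set V}) x y : conn Q -> x \in Q -> y \in Q ->
  exists p, [/\ path e x p, {subset x :: p <= Q}, uniq (x :: p) & last x p = y].
Proof.
move=> /connP cQ xQ yQ; have /connectP[p0 p0P y_def] := cQ x y xQ yQ.
case/shortenP: p0P y_def => p pP up _ ->; have [ep /allP aQ] := within_path pP.
by exists p; split => // z; rewrite inE => /orP[/eqP-> //|/aQ].
Qed.

End Connected.

Section Packing.
Variables (V : finType) (e : rel V).
Hypothesis e_sym : symmetric e.
Variable Tm : {set V}.
Local Notation conn := (conn e).

(** A vertex [y] at which a block can be entered from outside without loss: with
    the entering path, which brings a new terminal, [Q1] has two terminals, and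
    [Q2] keeps two of its own. *)
Definition splits (Q : {set V}) (y : V) : bool :=
  [exists Q1 : {set V}, [exists Q2 : {set V},
    [&& conn Q1, conn Q2, [disjoint Q1 & Q2], Q1 :|: Q2 \subset Q,
        y \in Q1, #|Q1 :&: Tm| == 1, #|Q2 :&: Tm| == 2 &
        Q :&: Tm \subset Q1 :|: Q2]]].

(** A block has either two terminals or three.  In the second case it behaves as
    a tripod: it splits wherever it is entered, except at its hub [h]. *)
Definition block (Q : {set V}) : bool :=
  conn Q && ((#|Q :&: Tm| == 2) || (#|Q :&: Tm| == 3) &&
    [exists h, [forall y in Q :\ h, splits Q y]]).

(** Entering a leg of a spider cuts that leg off, and the two other legs stay
    connected through the centre [h]. *)
Lemma spider_leg h s1 s2 s3 a b c (Q : {set V}) :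
  path e h s1 -> path e h s2 -> path e h s3 ->
  uniq (h :: s1 ++ s2 ++ s3) ->
  last h s1 = a -> last h s2 = b -> last h s3 = c ->
  Q :&: Tm = [set a; b; c] -> a != b -> a != c -> b != c ->
  Q = [set z in h :: s1 ++ s2 ++ s3] ->
  {in s1, forall y, splits Q y}.
Proof.
move=> p1 p2 p3 us l1 l2 l3 QT ab ac bc QE y ys.
have as1 : a \in s1.
  by rewrite -l1; case: s1 ys {p1 us l1 QE} => // z s _ /=; apply: mem_last.
set Q1 := [set z in s1]; set Q2 := [set z in h :: s2] :|: [set z in h :: s3].
have bQ2 : b \in Q2 by rewrite inE in_set -l2 mem_last.
have cQ2 : c \in Q2 by rewrite !inE -l3; have := mem_last h s3; rewrite inE => ->; rewrite orbT.
have d12 : [disjoint Q1 & Q2].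
  rewrite disjoint_subset; apply/subsetP => z; rewrite !inE => z1.
  move: us; rewrite /= cat_uniq mem_cat !negb_or => /andP[/andP[h1 _] /and3P[_ /hasPn H _]].
  have zh : z != h by apply: contraNneq h1 => <-.
  rewrite (negPf zh) /= -negb_or -mem_cat; apply/negP => /H.
  by rewrite z1.
have sub : Q1 :|: Q2 \subset Q.
  apply/subsetP => z; rewrite QE !inE mem_cat mem_cat.
  by do ?case: (_ \in _); rewrite ?orbT //=; case: eqP.
have TQ z : z \in Tm -> z \in Q -> [|| z == a, z == b | z == c].
  move=> zT zQ; have : z \in Q :&: Tm by rewrite inE zQ.
  by rewrite QT !inE orbA.
have inT z : [|| z == a, z == b | z == c] -> z \in Tm.
  move=> H; have : z \in Q :&: Tm by rewrite QT !inE -orbA.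
  by rewrite inE => /andP[].
have aQ1 : a \in Q1 by rewrite inE.
have dis z : z \in Q1 -> z \in Q2 -> False.
  by move=> z1 z2; have /pred0P/(_ z) := d12; rewrite /= z1 z2.
have E1 : Q1 :&: Tm = [set a].
  apply/setP => z; rewrite !inE; apply/andP/eqP => [[z1 zT]|->]; last first.
    by split=> //; apply: inT; rewrite eqxx.
  have zQ1 : z \in Q1 by rewrite inE.
  have zQ : z \in Q by apply: (subsetP sub); rewrite inE zQ1.
  by case/or3P: (TQ z zT zQ) => /eqP zE //; [case: (dis b) | case: (dis c)]; rewrite // -zE.
have E2 : Q2 :&: Tm = [set b; c].
  apply/setP => z; rewrite in_setI in_set2; apply/andP/idP => [[z2 zT]|zE]; last first.
    by split; [case/orP: zE => /eqP-> | apply: inT; rewrite zE orbT].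
  have zQ : z \in Q by apply: (subsetP sub); rewrite inE z2 orbT.
  by case/or3P: (TQ z zT zQ) => /eqP zE; rewrite zE ?eqxx ?orbT //; case: (dis a); rewrite // -zE.
apply/existsP; exists Q1; apply/existsP; exists Q2.
rewrite d12 sub E1 E2 cards1 cards2 bc !eqxx [y \in Q1]inE ys QT /=.
apply/and3P; split.
- by apply: conn_sorted => //; exact: path_sorted p1.
- apply: (@conn_join _ _ e_sym _ _ h h); rewrite ?inE ?eqxx //; exact: conn_path.
- apply/subsetP => z; rewrite in_setU in_set2 in_set1 => /orP[/orP[]|] /eqP->;
    by rewrite in_setU ?aQ1 ?bQ2 ?cQ2 ?orbT.
Qed.

Lemma cards3P (A : {set V}) : #|A| = 3 ->
  exists a b c, [/\ A = [set a; b; c], a != b, a != c & b != c].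
Proof.
move=> A3; have /card_gt0P[a aA] : 0 < #|A| by rewrite A3.
have : #|A :\ a| == 2 by move: A3; rewrite (cardsD1 a) aA add1n => -[->].
case/cards2P => b [c [bc AE]]; have : b \in A :\ a by rewrite AE !inE eqxx.
have : c \in A :\ a by rewrite AE !inE eqxx orbT.
rewrite !inE => /andP[ca _] /andP[ba _]; exists a, b, c; split => //; rewrite 1?eq_sym //.
by rewrite -(setD1K aA) AE setUA.
Qed.

Lemma path_around (s1 : seq V) (h : V) (s2 : seq V) : sorted e (s1 ++ h :: s2) ->
  [/\ path e h (rev s1), path e h s2 & sorted e (rcons s1 h)].
Proof.
rewrite -cat_rcons => ss.
have [s1P s2P] : sorted e (rcons s1 h) /\ path e h s2.
  case: s1 ss => [|x s1] //=; rewrite cat_path last_rcons => /andP[-> ->] //.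
split=> //; rewrite -[path _ _ _]/(sorted e (h :: rev s1)) -rev_rcons rev_sorted.
by rewrite (eq_sorted (e' := e)) // => x y; rewrite e_sym.
Qed.

Lemma split_first (T : eqType) (p : pred T) (s : seq T) : has p s ->
  exists s1 h s2, [/\ s = s1 ++ h :: s2, p h & ~~ has p s1].
Proof. by case/split_find => h s1 s2 ph ns; exists s1, h, s2; rewrite cat_rcons. Qed.

(** Take a path between two of the terminals and a path from the third one, up to
    its first meeting point with the former: this is a spider, and its centre is
    the hub. *)
Lemma tripod (Q : {set V}) : conn Q -> #|Q :&: Tm| = 3 ->
  exists Q' : {set V}, [/\ Q' \subset Q, block Q' & Q' :&: Tm = Q :&: Tm].
Proof.
move=> cQ Q3; have [a [b [c [QT ab ac bc]]]] := cards3P Q3.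
have inQ z : z \in [set a; b; c] -> z \in Q by rewrite -QT inE => /andP[].
have aQ : a \in Q by apply: inQ; rewrite !inE eqxx.
have bQ : b \in Q by apply: inQ; rewrite !inE eqxx orbT.
have cQ' : c \in Q by apply: inQ; rewrite !inE eqxx !orbT.
have [p [pP pQ up lp]] := conn_spath cQ aQ bQ.
have [r [rP rQ ur lr]] := conn_spath cQ cQ' bQ.
have hasr : has (mem (a :: p)) (c :: r).
  by apply/hasP; exists b; [rewrite -lr | rewrite /= -lp]; apply: mem_last.
have [r1 [h [r2 [rE hp r1p]]]] := split_first hasr.
have [p1 [p2 pE]] : exists p1 p2, a :: p = p1 ++ h :: p2.
  by move: hp => /= hp; case/splitPr: hp => p1 p2; exists p1, p2.
have [P1 P2 _] : [/\ path e h (rev p1), path e h p2 & sorted e (rcons p1 h)].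
  by apply: path_around; rewrite -pE.
have [P3 _ _] : [/\ path e h (rev r1), path e h r2 & sorted e (rcons r1 h)].
  by apply: path_around; rewrite -rE.
have l1 : last h (rev p1) = a.
  by case: (p1) pE => [|x s] [-> //] _; rewrite rev_cons last_rcons.
have l2 : last h p2 = b by rewrite -lp -[last a p]/(last a (a :: p)) pE last_cat.
have l3 : last h (rev r1) = c.
  by case: (r1) rE => [|x s] [-> //] _; rewrite rev_cons last_rcons.
set s := h :: rev p1 ++ p2 ++ rev r1.
have us : uniq s.
  have -> : uniq s = uniq ((a :: p) ++ r1).
    apply/perm_uniq/permP => q; rewrite pE /s /= !count_cat !count_rev /=.
    by rewrite addnCA !addnA.
  rewrite cat_uniq up -[has _ r1]/(has (mem (a :: p)) r1) r1p /=.
  by move: ur; rewrite rE cat_uniq => /and3P[].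
set Q' := [set z in s].
have Q'Q : Q' \subset Q.
  apply/subsetP => z; rewrite inE /s inE !mem_cat !mem_rev => zs.
  have [/pQ //|zp] := boolP (z \in a :: p).
  apply: rQ; rewrite rE mem_cat; move: zp zs.
  rewrite pE mem_cat inE !negb_or => /and3P[/negPf-> /negPf-> /negPf->] /=.
  by move=> ->.
have ls (x : V) (t : seq V) : last x t \in x :: t by apply: mem_last.
have QT' : Q' :&: Tm = Q :&: Tm.
  apply/eqP; rewrite eqEsubset setSI //=; apply/subsetP => z zQT.
  have zT : z \in Tm by move: zQT; rewrite inE => /andP[].
  rewrite inE zT andbT inE /s inE !mem_cat.
  have := zQT; rewrite QT !inE => /orP[/orP[]|] /eqP->.
  - by have := ls h (rev p1); rewrite l1 inE => /orP[]->; rewrite ?orbT.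
  - by have := ls h p2; rewrite l2 inE => /orP[]->; rewrite ?orbT.
  - by have := ls h (rev r1); rewrite l3 inE => /orP[]->; rewrite ?orbT.
exists Q'; split=> //; rewrite /block QT' Q3 eqxx /=; apply/andP; split.
  have -> : Q' = [set z in h :: rev p1] :|: ([set z in h :: p2] :|: [set z in h :: rev r1]).
    by apply/setP => z; rewrite !inE !mem_cat; case: eqP.
  apply: (@conn_join _ _ e_sym _ _ h h); rewrite ?inE ?eqxx //; first exact: conn_path.
  by apply: (@conn_join _ _ e_sym _ _ h h); rewrite ?inE ?eqxx //; exact: conn_path.
have perm3 (x y z : seq V) : perm_eq (h :: x ++ y ++ z) (h :: y ++ x ++ z).
  by rewrite perm_cons perm_catCA.
have perm3' (x y z : seq V) : perm_eq (h :: x ++ y ++ z) (h :: z ++ x ++ y).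
  by rewrite perm_cons catA perm_catC.
have setp (x y : seq V) : perm_eq x y -> [set z in x] = [set z in y].
  by move=> /perm_mem H; apply/setP => z; rewrite !inE H.
have set3 (x y z : V) : [set x; y; z] = [set y; x; z] by rewrite [[set x; y]]setUC.
have set3' (x y z : V) : [set x; y; z] = [set z; x; y] by rewrite setUC setUA.
apply/existsP; exists h; apply/forall_inP => y; rewrite !inE => /andP[yh].
rewrite (negPf yh) /= !mem_cat => /or3P[] ys.
- by apply: (spider_leg P1 P2 P3 us l1 l2 l3 _ ab ac bc _ ys); rewrite // QT'.
- have us' : uniq (h :: p2 ++ rev p1 ++ rev r1) by rewrite -(perm_uniq (perm3 _ _ _)).
  apply: (spider_leg P2 P1 P3 us' l2 l1 l3 _ _ bc ac _ ys); rewrite 1?eq_sym //.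
    by rewrite QT' QT set3.
  exact/setp/perm3.
- have us' : uniq (h :: rev r1 ++ rev p1 ++ p2) by rewrite -(perm_uniq (perm3' _ _ _)).
  apply: (spider_leg P3 P1 P2 us' l3 l1 l2 _ _ _ ab _ ys); rewrite 1?eq_sym //.
    by rewrite QT' QT set3'.
  exact/setp/perm3'.
Qed.

Definition block_family (F : {set {set V}}) := trivIset F && [forall Q in F, block Q].
Definition covered (F : {set {set V}}) := #|cover F :&: Tm|.

(** Replacing the blocks in [F0] by those in [G] is a strict gain when no terminal
    is lost and the uncovered [d] is gained. *)
Lemma block_family_exchange (F F0 G : {set {set V}}) d :
  block_family F -> F0 \subset F -> block_family G ->
  [disjoint cover G & cover (F :\: F0)] ->
  cover F0 :&: Tm \subset cover G -> d \in cover G -> d \in Tm ->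
  d \notin cover F -> exists2 F', block_family F' & covered F < covered F'.
Proof.
move=> /andP[tF /forall_inP bF] F0F /andP[tG /forall_inP bG] dis sub dG dT dF.
exists (G :|: (F :\: F0)).
  apply/andP; split; first by apply: trivIsetU => //; apply: trivIsetD.
  by apply/forall_inP => Q /setUP[/bG//|/setDP[/bF]].
apply: proper_card; apply/properP; split.
  apply/subsetP => z; rewrite !inE => /andP[/bigcupP[Q QF zQ] zT]; rewrite zT andbT.
  have [QF0|QF0] := boolP (Q \in F0).
    have zG : z \in cover G.
      by apply: (subsetP sub); rewrite inE zT andbT; apply/bigcupP; exists Q.
    by rewrite /cover bigcup_setU inE -/(cover G) zG.
  by apply/bigcupP; exists Q => //; rewrite !inE QF0 QF orbT.
exists d; last by rewrite inE (negPf dF).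
by rewrite inE dT andbT /cover bigcup_setU inE -/(cover G) dG.
Qed.

Lemma block_family1 (Q : {set V}) : block Q -> block_family [set Q].
Proof.
by move=> bQ; rewrite /block_family trivIset1 /=; apply/forall_inP => B /set1P->.
Qed.

Lemma block_family2 (Q1 Q2 : {set V}) :
  block Q1 -> block Q2 -> [disjoint Q1 & Q2] -> block_family [set Q1; Q2].
Proof.
move=> b1 b2 d12; apply/andP; split; last by apply/forall_inP => B /set2P[]->.
by apply: trivIsetU; rewrite ?trivIset1 ?cover1.
Qed.

Lemma block2 (Q : {set V}) : conn Q -> #|Q :&: Tm| = 2 -> block Q.
Proof. by move=> cQ /eqP Q2; rewrite /block cQ Q2. Qed.

Lemma disjoint_cover (F : {set {set V}}) (Q D : {set V}) :
  trivIset F -> Q \in F -> D \subset Q ->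
  [disjoint D & cover (F :\ Q)].
Proof.
move=> tF QF DQ; rewrite coverD1 // disjoint_subset; apply/subsetP => z zD.
by rewrite !inE (subsetP DQ z zD).
Qed.

Lemma cover2 (A B : {set V}) : cover [set A; B] = A :|: B.
Proof. by rewrite /cover bigcup_setU !big_set1. Qed.

(** The augmentation step.  A connected [D] brings the uncovered terminal [d] next
    to a vertex [y].  If [y] is an uncovered terminal, [D] and [y] form a new
    block.  If [y] is in a block with two terminals, the union contains a tripod;
    if it is in a tripod, away from the hub, the tripod splits and one part
    absorbs [D]. *)
Lemma block_family_augment (F : {set {set V}}) (D : {set V}) d x y :
  block_family F -> conn D -> d \in D ->
  [disjoint D & cover F] -> D :&: Tm = [set d] -> x \in D -> e x y ->
  (y \in Tm /\ y != d /\ y \notin cover F) \/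
  (exists2 Q, Q \in F & y \in Q /\ (#|Q :&: Tm| = 3 -> splits Q y)) ->
  exists2 F', block_family F' & covered F < covered F'.
Proof.
move=> fF cD dD disD DT xD xy.
have dT : d \in Tm by have := set11 d; rewrite -DT inE => /andP[].
have dF : d \notin cover F.
  by apply/negP => dF; have /pred0P/(_ d) := disD; rewrite /= dD dF.
have tF : trivIset F by case/andP: fF.
case=> [[yT [yd yF]]|[Q QF [yQ Qs]]].
  have c2 : conn (D :|: [set y]).
    by apply: (@conn_join _ _ e_sym _ _ x y) => //; rewrite ?conn1 ?set11 ?xy ?orbT.
  have b2 : block (D :|: [set y]).
    apply: block2 => //; rewrite setIUl DT (setIidPl _) ?sub1set //.
    by rewrite cards2 eq_sym yd.
  apply: (@block_family_exchange F set0 _ d fF (sub0set _) (block_family1 b2)) => //; rewrite ?cover1.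
  - rewrite setD0 disjoint_subset; apply/subsetP => z /setUP[zD|/set1P->] //.
    by move: disD; rewrite disjoint_subset => /subsetP/(_ z zD).
  - by rewrite /cover big_set0 set0I sub0set.
  - by rewrite inE dD.
have dQ : d \notin Q by apply: contra dF => dQ; apply/bigcupP; exists Q.
have F0F : [set Q] \subset F by rewrite sub1set.
have disR : [disjoint D & cover (F :\ Q)].
  by apply: disjointWr disD; rewrite coverD1 // subsetDl.
have bQ : block Q by case/andP: fF => _ /forall_inP/(_ _ QF).
have DQT : (D :|: Q) :&: Tm = d |: (Q :&: Tm) by rewrite setIUl DT.
have [cQ] := andP bQ; have [/eqP Q2 _|Q2 /=] := boolP (#|Q :&: Tm| == 2).
  have cU : conn (D :|: Q) by apply: (@conn_join _ _ e_sym _ _ x y) => //; rewrite xy orbT.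
  have [|Q' [Q'U bQ' Q'T]] := tripod cU.
    by rewrite DQT cardsU1 Q2 inE (negPf dQ).
  apply: (@block_family_exchange F [set Q] _ d fF F0F (block_family1 bQ')) => //; rewrite ?cover1.
  - apply: disjointWl Q'U _; rewrite disjoint_subset; apply/subsetP => z /setUP[] zD.
      by move: disR; rewrite disjoint_subset => /subsetP/(_ z zD).
    by have := disjoint_cover tF QF (subxx Q); rewrite disjoint_subset => /subsetP/(_ z zD).
  - apply: (@subset_trans _ _ (Q' :&: Tm)); last exact: subsetIl.
    by rewrite Q'T setSI // subsetUr.
  - by have := setU11 d (Q :&: Tm); rewrite -DQT -Q'T inE => /andP[].
case/andP => /eqP Q3 _; have := Qs Q3.
case/existsP => Q1 /existsP[Q0 /and5P[c1 c0 d10 sU /and4P[yQ1 /eqP q1 /eqP q0 cT]]].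
have s1 : Q1 \subset Q by apply: subset_trans sU; apply: subsetUl.
have s0 : Q0 \subset Q by apply: subset_trans sU; apply: subsetUr.
have bD : block (D :|: Q1).
  apply: block2.
    by apply: (@conn_join _ _ e_sym _ _ x y) => //; rewrite xy orbT.
  rewrite setIUl DT cardsU1 q1 inE negb_and; case: (boolP (d \in Q1)) => // dQ1.
  by rewrite (subsetP s1 _ dQ1) in dQ.
have dD0 : [disjoint D & Q].
  apply: disjointWr disD; exact: bigcup_sup.
have dd : [disjoint D :|: Q1 & Q0].
  rewrite disjoint_subset; apply/subsetP => z /setUP[] zD.
    apply/negP => z0; have /pred0P/(_ z) := dD0; by rewrite /= zD (subsetP s0 _ z0).
  by move: d10; rewrite disjoint_subset => /subsetP/(_ z zD).
apply: (@block_family_exchange F [set Q] _ d fF F0F (block_family2 bD (block2 c0 q0) dd)) => //; rewrite ?cover1 ?cover2.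
- rewrite disjoint_subset; apply/subsetP => z; rewrite -setUA => /setUP[] zD.
    by move: disR; rewrite disjoint_subset => /subsetP/(_ z zD).
  by have := disjoint_cover tF QF sU; rewrite disjoint_subset => /subsetP/(_ z zD).
- by rewrite -setUA; apply: subset_trans cT _; apply: subsetUr.
- by rewrite !inE dD.
Qed.

Definition hubs (Q : {set V}) : {set V} :=
  if #|Q :&: Tm| == 3 then
    if [pick h | [forall y in Q :\ h, splits Q y]] is Some h then [set h] else set0
  else set0.

Lemma card_hubs (Q : {set V}) : #|hubs Q| <= 1.
Proof.
by rewrite /hubs; case: ifP => _; rewrite ?cards0 //; case: pickP => *; rewrite ?cards0 ?cards1.
Qed.

Lemma hubsP (Q : {set V}) y :
  block Q -> y \in Q -> y \notin hubs Q -> #|Q :&: Tm| = 3 -> splits Q y.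
Proof.
move=> /andP[_ bQ] yQ; rewrite /hubs => + Q3; move: bQ; rewrite Q3 /= => /existsP[h hP].
case: pickP => [h' /forall_inP h'P | /(_ h)]; last by rewrite hP.
by rewrite inE => yh; apply: h'P; rewrite !inE yh.
Qed.

(** A weak form of Gallai's theorem on disjoint paths between terminals.  Take a
    family of disjoint blocks covering as many terminals as possible; the hubs of
    its tripods form [S], and the uncovered terminals form [O].  A path avoiding
    [S] from a terminal of [O] to a block or to another terminal of [O] would
    permit an augmentation. *)
Theorem packing : exists (F : {set {set V}}) (S O : {set V}),
  [/\ trivIset F, forall Q, Q \in F -> conn Q /\ 1 < #|Q :&: Tm|, #|S| <= #|F| &
   [/\ O \subset Tm, #|Tm| <= #|O| + 3 * #|F|, [disjoint O & S] &
      {in O &, forall d d', d != d' -> ~~ connect (within e (~: S)) d d'}]].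
Proof.
have f0 : block_family set0.
  apply/andP; split; last by apply/forall_inP => Q; rewrite inE.
  by apply/trivIsetP => A B; rewrite inE.
case: (@arg_maxnP _ set0 block_family covered f0) => F fF Fmax.
have {}Fmax : ~ exists2 F', block_family F' & covered F < covered F'.
  by case=> F' /Fmax /= le /(leq_ltn_trans le); rewrite ltnn.
have [tF /forall_inP bF] := andP fF.
pose S := cover F :&: \bigcup_(Q in F) hubs Q; pose O := Tm :\: cover F.
have Ssub : S \subset cover F by apply: subsetIl.
exists F, S, O; split=> //.
- move=> Q /bF /andP[-> /orP[/eqP->|/andP[/eqP->]]] //.
- apply: (leq_trans (subset_leq_card (subsetIr _ _))).
  apply: (leq_trans (card_bigcup_le _ _)).
  by rewrite -sum1_card leq_sum // => Q _; apply: card_hubs.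
split.
- exact: subsetDl.
- rewrite -(cardsID (cover F) Tm) addnC leq_add2l setIC.
  have -> : cover F :&: Tm = \bigcup_(Q in F) (Q :&: Tm) by rewrite /cover big_distrl.
  apply: (leq_trans (card_bigcup_le _ _)).
  rewrite mulnC -sum_nat_const leq_sum // => Q /bF /andP[_ /orP[/eqP->|/andP[/eqP->]]] //.
- rewrite disjoint_subset; apply/subsetP => z /setDP[_ zF].
  by apply: contra zF => /(subsetP Ssub).
move=> d d' /setDP[dT dF] /setDP[dT' dF'] dd'; apply/negP => /connectP[p0 p0P d'_def].
case/shortenP: p0P d'_def => p pP up _ d'E.
have [ep /allP pS] := within_path pP.
pose B := cover F :|: Tm.
have hasB : has (mem B) p.
  apply/hasP; exists d'; last by rewrite inE /= inE dT' orbT.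
  by have := mem_last d p; rewrite -d'E inE eq_sym (negPf dd') /=.
have [p1 [y [p2 [pE yB p1B]]]] := split_first hasB.
apply: Fmax; apply: (@block_family_augment F [set z in d :: p1] d (last d p1) y fF).
- by apply: conn_path => //; move: ep; rewrite pE cat_path => /andP[].
- by rewrite !inE eqxx.
- rewrite disjoint_subset; apply/subsetP => z; rewrite !inE => /orP[/eqP->//|zp].
  by move/hasPn: p1B => /(_ z zp) /=; rewrite inE negb_or => /andP[].
- apply/setP => z; rewrite !inE; case: eqP => [->|_] //=; apply/negP => /andP[zp zT].
  by move/hasPn: p1B => /(_ z zp) /=; rewrite inE negb_or zT andbF.
- by rewrite inE mem_last.
- by move: ep; rewrite pE cat_path /= => /and3P[].
have [/bigcupP[Q QF yQ]|yF] := boolP (y \in cover F).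
  right; exists Q => //; split=> // Q3; apply: hubsP => //; first exact: bF.
  have yp : y \in p by rewrite pE mem_cat inE eqxx orbT.
  have : y \notin S by have := pS y yp; rewrite /= inE.
  apply: contra => yh; rewrite inE; apply/andP.
  by split; apply/bigcupP; exists Q.
left; split; first by move: yB; rewrite /= inE (negPf yF).
split=> //; move: up; rewrite pE /= mem_cat inE !negb_or eq_sym.
by case/andP => /and3P[].
Qed.

End Packing.

(** * Random colourings and union bounds *)

Section Coloring.
Variables (V C : finType).
Implicit Types (f g : {ffun V -> C}) (E : {set V}) (M : {set {set V}}).

Definition recolor f E j := [ffun v => if v \in E then j else f v].
Definition mono f E j := E \subset [set v | f v == j].

(** A colouring is determined by its recolouring on [E] and its values on [E]. *)
Lemma card_recolor_fibre g E j : #|[set f | recolor f E j == g]| <= #|C| ^ #|E|.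
Proof.
pose F v : pred C := if v \in E then predT else pred1 (g v).
apply: (@leq_trans #|family F|).
  apply: subset_leq_card; apply/subsetP => f; rewrite inE => /eqP fg.
  apply/familyP => v; rewrite /F; case: ifPn => // vE.
  by rewrite -fg !inE ffunE (negPf vE).
rewrite card_family foldrE big_map big_enum /=.
rewrite (bigID (mem E)) /= [X in _ * X]big1 ?muln1 => [|v /negPf vE].
  rewrite (eq_bigr (fun=> #|C|)) ?prod_nat_const // => v vE.
  by rewrite /F vE.
by rewrite /F vE card1.
Qed.

(** Given [A], the event that [E] gets colour [j] throughout has probability at
    least #|C| ^ - #|E|, provided that [A] does not constrain colour [j] on [E]. *)
Lemma mono_frequent (A : {set {ffun V -> C}}) E j :
  {in A, forall f, recolor f E j \in A} ->
  #|A| <= #|[set f in A | mono f E j]| * #|C| ^ #|E|.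
Proof.
move=> clA; set B := [set f in A | mono f E j].
have RB f : f \in A -> recolor f E j \in B.
  by move=> fA; rewrite inE clA //; apply/subsetP => v vE; rewrite inE ffunE vE.
rewrite -sum1_card (partition_big (fun f => recolor f E j) (mem B)) //=.
rewrite -sum_nat_const leq_sum // => g _; apply: leq_trans (card_recolor_fibre g E j).
by rewrite sum1dep_card; apply/subset_leq_card/subsetP => f; rewrite !inE => /andP[].
Qed.

(** Disjoint sets behave as if they were independent: conditioning on some of
    them not being monochromatic leaves an event that is still closed under
    recolouring the others. *)
Lemma avoid_family (A : {set {ffun V -> C}}) M j h :
  trivIset M -> (forall E, E \in M -> #|E| <= h) -> 0 < #|C| ->
  {in A & M, forall f E, recolor f E j \in A} ->
  #|[set f in A | [forall E in M, ~~ mono f E j]]| * (#|C| ^ h) ^ #|M|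
    <= (#|C| ^ h).-1 ^ #|M| * #|A|.
Proof.
move=> + + C0; move mE: #|M| => m; elim: m M mE => [|m IH] M mE tM hM clA.
  rewrite !expn0 muln1 mul1n; apply/subset_leq_card/subsetP => f; rewrite inE.
  by case/andP.
have /card_gt0P[E0 E0M] : 0 < #|M| by rewrite mE.
have mE' : #|M :\ E0| = m by move: mE; rewrite (cardsD1 E0) E0M add1n => -[].
have M'M E : E \in M :\ E0 -> E \in M by rewrite inE => /andP[].
have := IH _ mE' (trivIsetD _ tM) (fun E EM => hM E (M'M E EM))
  (fun f E fA EM => clA f E fA (M'M E EM)).
set A' := [set f in A | _].
have clA' : {in A', forall f, recolor f E0 j \in A'}.
  move=> f; rewrite !inE => /andP[fA /forall_inP fM]; rewrite clA //=.
  apply/forall_inP => E EM; apply: contra (fM E EM) => /subsetP mEf.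
  apply/subsetP => v vE; have := mEf v vE; rewrite !inE ffunE ifN //.
  have := EM; rewrite !inE => /andP[EE0 EM'].
  have /trivIsetP/(_ E E0 EM' E0M EE0)/pred0P/(_ v) := tM.
  by rewrite /= vE /= => ->.
have := mono_frequent clA'; set B := [set f in A' | mono f E0 j] => A'B IHm.
set A2 := [set f in A | _].
have A2E : A2 \subset A' :\: B.
  apply/subsetP => f; rewrite !inE => /andP[-> /forall_inP fM] /=.
  rewrite (negPf (fM _ E0M)) andbF /=; apply/forall_inP => E /M'M; exact: fM.
have BA' : B \subset A' by apply/subsetP => f; rewrite inE => /andP[].
have := subset_leq_card A2E; rewrite cardsD (setIidPr BA') => A2le.
have hE : #|C| ^ #|E0| <= #|C| ^ h by rewrite leq_pexp2l ?hM.
set a := #|C| ^ h in IHm hE *.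
have a0 : 0 < a by rewrite expn_gt0 C0.
have A'a : #|A'| <= #|B| * a by apply: leq_trans A'B _; rewrite leq_mul2l hE orbT.
have A2a : #|A2| * a <= a.-1 * #|A'| by nia.
rewrite !expnS mulnA; apply: (leq_trans (leq_mul A2a (leqnn _))).
by rewrite -!mulnA leq_mul2l IHm orbT.
Qed.

(** (1 - 1/a)^r <= 2^-c for r >= a c; the case c = 1 is Bernoulli's inequality. *)
Lemma pred_exp_halves a c r : 0 < a -> a * c <= r -> a.-1 ^ r * 2 ^ c <= a ^ r.
Proof.
case: a => // a _; rewrite succnK => acr.
have H : a ^ a.+1 * 2 <= a.+1 ^ a.+1.
  case: a {acr} => // a; rewrite -[in a.+2 ^ _](addn1 a.+1) expnDn.
  rewrite !big_ord_recl /= !exp1n !muln1 bin0 mul1n bin1 /bump /= subn0 subn1 /=.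
  have : a.+1 ^ a.+2 <= a.+2 * a.+1 ^ a.+1 by rewrite expnS leq_mul2r leqnSn orbT.
  lia.
have Hc : a ^ (a.+1 * c) * 2 ^ c <= a.+1 ^ (a.+1 * c).
  rewrite expnM (expnM a.+1) -expnMn; case: c {acr} => // c.
  by rewrite leq_exp2r // succnK.
rewrite -(subnKC acr); move: (a.+1 * c) Hc => d Hd.
rewrite !expnD mulnAC; apply: leq_mul => //.
by case: (r - _) => // n; rewrite leq_exp2r.
Qed.

Lemma avoid_rare (A : {set {ffun V -> C}}) M j h c :
  trivIset M -> (forall E, E \in M -> #|E| <= h) -> 0 < #|C| ->
  {in A & M, forall f E, recolor f E j \in A} ->
  #|C| ^ h * c <= #|M| ->
  #|[set f in A | [forall E in M, ~~ mono f E j]]| * 2 ^ c <= #|A|.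
Proof.
move=> tM hM C0 clA cM; have a0 : 0 < #|C| ^ h by rewrite expn_gt0 C0.
have := avoid_family tM hM C0 clA; have := pred_exp_halves a0 cM.
set B := #|[set f in A | _]|; set a := #|C| ^ h in a0 *; set r := #|M|.
move=> H1 H2; rewrite -(leq_pmul2l (m := a ^ r)) ?expn_gt0 ?C0 //.
rewrite mulnA [a ^ r * B]mulnC; apply: (leq_trans (leq_mul H2 (leqnn _))).
by rewrite mulnAC leq_mul2r H1 orbT.
Qed.

End Coloring.

Lemma union_bound (T I : finType) (F : I -> {set T}) b c N :
  #|I| <= 2 ^ b -> (forall i, #|F i| * 2 ^ (b + c) <= N) ->
  #|\bigcup_i F i| * 2 ^ c <= N.
Proof.
move=> Ib FN; rewrite -(leq_pmul2l (m := 2 ^ b)) ?expn_gt0 //.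
rewrite mulnCA -expnD; apply: (leq_trans (leq_mul (card_bigcup_le _ _) (leqnn _))).
rewrite big_distrl /=; apply: (@leq_trans (\sum_(i : I) N)); first exact: leq_sum.
by rewrite sum_nat_const leq_mul2r Ib orbT.
Qed.

Lemma ffact_leq_expn n m : n ^_ m <= n ^ m.
Proof.
elim: m n => // m IH [|n]; rewrite ?ffact0n // ffactnS expnS leq_mul2l /=.
case: m IH => // m IH; apply: leq_trans (IH n) _; by rewrite leq_exp2r.
Qed.

Lemma bin_leq_expn n m : 'C(n, m) <= n ^ m.
Proof.
apply: leq_trans (ffact_leq_expn n m).
by rewrite -bin_ffact leq_pmulr // fact_gt0.
Qed.

(** A union bound over all sets [S]: there are at most n ^ s of them of size s, so
    a failure probability of 2 ^ - l (s + a + 1), with n < 2 ^ l, absorbs their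
    number and the summation over s. *)
Lemma union_bound_sets (V T : finType) (F : {set V} -> {set T}) l a N :
  #|V| < 2 ^ l -> (forall S : {set V}, #|F S| * 2 ^ (l * (#|S| + a.+1)) <= N) ->
  #|\bigcup_S F S| * 2 ^ (l * a) <= N.
Proof.
set n := #|V|; set w := 2 ^ l => nw FN.
have w0 : 0 < w by rewrite expn_gt0.
rewrite expnM -/w; rewrite -(leq_pmul2r (m := w ^ n.+1)) ?expn_gt0 ?w0 //.
rewrite -mulnA -expnD.
apply: (leq_trans (leq_mul (card_bigcup_le _ _) (leqnn _))); rewrite big_distrl /=.
apply: (@leq_trans (\sum_(S : {set V}) N * w ^ (n - #|S|))).
  apply: leq_sum => S _; have := FN S; rewrite expnM -/w => H.
  have Sn : #|S| <= n by apply: max_card.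
  have -> : a + n.+1 = (#|S| + a.+1) + (n - #|S|) by lia.
  by rewrite expnD mulnA leq_mul2r H orbT.
rewrite -big_distrr /= leq_mul2l; apply/orP; right.
rewrite (partition_big (fun S : {set V} => inord #|S| : 'I_n.+1) predT) //=.
apply: (@leq_trans (\sum_(s < n.+1) w ^ n)); last first.
  by rewrite sum_nat_const card_ord expnS leq_mul2r nw orbT.
apply: leq_sum => s _.
rewrite (eq_bigr (fun=> w ^ (n - s))) => [|S /eqP <-]; last first.
  by rewrite inordK // ltnS max_card.
rewrite sum_nat_const.
have -> : #|[pred S : {set V} | inord #|S| == s]| = 'C(n, s).
  rewrite -card_draws -cardsE; apply: eq_card => S; rewrite !inE.
  by rewrite -val_eqE /= inordK // ltnS max_card.
have sn : s <= n by rewrite -ltnS.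
rewrite -[in w ^ n](subnKC sn) expnD leq_mul2r; apply/orP; right.
apply: leq_trans (_ : n ^ s <= _); last first.
  by case: (nat_of_ord s) => // s'; rewrite leq_exp2r // ltnW.
exact: bin_leq_expn.
Qed.

(** * Toughness, connectors and the number of small cuts *)

(** The contraction of the label [b] into the label [a]. *)
Lemma contract_ord N (a b : 'I_N.+1) : a != b -> exists c : 'I_N.+1 -> 'I_N,
  (forall z, c (lift b z) = z) /\ forall x, lift b (c x) = if x == b then a else x.
Proof.
rewrite eq_sym => ba; have [a' aE _] := unlift_some ba.
exists (fun x => odflt a' (unlift b x)); split=> [z|x]; first by rewrite liftK.
by case: unliftP => [j|] ->; rewrite ?eqxx //= eq_sym (negPf (neq_lift _ _)).
Qed.

Section Toughness.
Variables (V : finType) (e : rel V).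
Hypothesis e_sym : symmetric e.

(** Toughness in terms of labellings that are constant on the components of the
    graph outside [W].  The labels need not separate components, so that lower
    bounds on the number of components are obtained by exhibiting a labelling. *)
Definition label_tough (T : nat) := forall k (W : {set V}) (lab : V -> 'I_k), 1 < k ->
  (forall x y, x \notin W -> y \notin W -> e x y -> lab x = lab y) ->
  (forall c, exists2 x, x \notin W & lab x = c) -> T * k <= #|W|.

Definition cadj v w := (v == w) || e v w.
Definition nbh (Z : {set V}) := [set w | [exists z in Z, cadj z w]].
(** The vertices that [R] does not dominate any more once [S] is deleted. *)
Definition trapped (R S : {set V}) := [set v | nbh [set v] :&: R \subset S].

Lemma cadj_sym v w : cadj v w = cadj w v.
Proof. by rewrite /cadj eq_sym e_sym. Qed.

Lemma cadjxx v : cadj v v. Proof. by rewrite /cadj eqxx. Qed.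

Lemma mem_nbh1 v w : (w \in nbh [set v]) = cadj v w.
Proof.
rewrite inE; apply/existsP/idP => [[z /andP[/set1P->]]//|vw].
by exists v; rewrite set11.
Qed.

Section Cuts.
Variables (R S : {set V}).
Let D := R :\: S.

(** A connector of [g] is a vertex (when v = w) or an edge outside [R] and [S]
    through which two [D]-vertices with different labels are joined. *)
Definition connector k (g : V -> 'I_k) (E : {set V}) : bool :=
  [exists v, exists w, exists x, exists y,
    [&& E == [set v; w], [disjoint E & R :|: S], cadj v w,
        x \in D, y \in D, cadj v x, cadj w y & g x != g y]].

Lemma connectorP k (g : V -> 'I_k) E : reflect
  (exists v w x y, [/\ E = [set v; w], [disjoint E & R :|: S], cadj v w &
     [/\ x \in D, y \in D, cadj v x, cadj w y & g x != g y]])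
  (connector g E).
Proof.
apply: (iffP idP).
  case/existsP=> v /existsP[w] /existsP[x] /existsP[y].
  by case/and5P=> /eqP ? ? ? ? /and4P[*]; exists v, w, x, y.
case=> v [w [x [y [-> d vw [? ? ? ? ?]]]]].
apply/existsP; exists v; apply/existsP; exists w; apply/existsP; exists x.
by apply/existsP; exists y; rewrite eqxx d vw /=; apply/and5P.
Qed.

Definition packs k (g : V -> 'I_k) (M : {set {set V}}) : bool :=
  trivIset M && [forall E in M, connector g E].

Definition packnum k (g : V -> 'I_k) : nat := \max_(M | packs g M) #|M|.

(** The labellings of the components of the graph on [D], up to merging some. *)
Definition labelling k (g : V -> 'I_k) :=
  {in D &, forall x y, e x y -> g x = g y} /\ (forall c, exists2 x, x \in D & g x = c).

Lemma packs0 k (g : V -> 'I_k) : packs g set0.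
Proof.
apply/andP; split; last by apply/forall_inP => E; rewrite inE.
by apply/trivIsetP => A B; rewrite inE.
Qed.

Lemma packnum_attained k (g : V -> 'I_k) : exists2 M, packs g M & #|M| = packnum g.
Proof.
have P0 : 0 < #|[pred M | packs g M]|.
  by apply/card_gt0P; exists set0; apply: packs0.
by have [M MP ME] := eq_bigmax_cond (fun M : {set {set V}} => #|M|) P0; exists M.
Qed.

Lemma packnum_ge k (g : V -> 'I_k) M : packs g M -> #|M| <= packnum g.
Proof. by move=> MP; apply: (bigmax_sup M). Qed.

Lemma eq_connector k k' (g : V -> 'I_k) (g' : V -> 'I_k') E :
  {in D &, forall x y, (g x == g y) = (g' x == g' y)} ->
  connector g E = connector g' E.
Proof.
move=> gg'; apply/connectorP/connectorP => -[v [w [x [y [EE d vw [xD yD vx wy gxy]]]]]];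
  exists v, w, x, y; split=> //; split=> //.
  by rewrite -gg'.
by rewrite gg'.
Qed.

Lemma eq_packnum k k' (g : V -> 'I_k) (g' : V -> 'I_k') :
  {in D &, forall x y, (g x == g y) = (g' x == g' y)} -> packnum g = packnum g'.
Proof.
move=> gg'; apply: eq_bigl => M; rewrite /packs; congr (_ && _).
by apply: eq_forallb => E; rewrite (eq_connector _ gg').
Qed.

Lemma packsU1 k (g : V -> 'I_k) M E : packs g M -> connector g E ->
  [disjoint E & cover M] -> packs g (E |: M) /\ #|E |: M| = #|M|.+1.
Proof.
move=> /andP[tM /forall_inP cM] cE dE.
have EM : E \notin M.
  case/connectorP: cE => v [w [_ [_ [EE _ _ _]]]].
  apply/negP => EM; have /pred0P/(_ v) := dE; rewrite /= EE !inE eqxx /=.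
  by move/bigcupP; apply; exists E => //; rewrite EE !inE eqxx.
split; last by rewrite cardsU1 EM.
apply/andP; split; first by apply: trivIsetU; rewrite ?trivIset1 ?cover1.
by apply/forall_inP => E' /setU1P[->|/cM].
Qed.

Variables (T X Th : nat).
Hypothesis toughT : label_tough T.
Hypothesis TTh : 4 * Th <= T.
Hypothesis XTh : X.+1 <= 2 * Th.
Hypothesis badX : #|trapped R S| <= X * #|S|.

(** Delete [S], the trapped vertices and a maximum family of disjoint connectors.
    By maximality every remaining vertex sees exactly one label, and adjacent
    vertices see the same one: so [k] components are left, and toughness bounds
    the number of deleted vertices from below. *)
Lemma packnum_lower_bound k (g : V -> 'I_k) : 1 < k -> #|S| <= k -> labelling g ->
  Th * k <= packnum g.
Proof.
move=> k1 Sk [gD gonto]; have [M pM ME] := packnum_attained g.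
have [tM /forall_inP cM] := andP pM.
have Mmax E : connector g E -> ~~ [disjoint E & cover M].
  move=> cE; apply/negP => dE; have [pE EE] := packsU1 pM cE dE.
  by have := packnum_ge pE; rewrite EE ME ltnn.
pose W := S :|: trapped R S :|: cover M.
(* the label that v sees; v is a dummy default *)
pose L v := g (odflt v [pick x in D | cadj v x]).
have MD z : z \in D -> z \notin cover M.
  move=> zD; apply/bigcupP => -[E /cM/connectorP[_ [_ [_ [_ [_ d _ _]]]]] zE].
  by have /pred0P/(_ z) := d; rewrite /= zE; move: zD; rewrite !inE => /andP[_ ->].
have rep v : v \notin W -> exists x, [/\ x \in D, cadj v x & L v = g x].
  rewrite !inE !negb_or => /andP[/andP[_ /subsetPn[x]]].
  rewrite inE mem_nbh1 => /andP[vx xR] xS _; rewrite /L; case: pickP => [y /andP[]|/(_ x)] /=.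
    by exists y.
  by rewrite inE xS xR vx.
have dW v w : v \notin W -> w \notin W -> v \notin R -> w \notin R ->
    [disjoint [set v; w] & R :|: S] /\ [disjoint [set v; w] & cover M].
  rewrite !inE !negb_or => /andP[/andP[vS _] vM] /andP[/andP[wS _] wM] vR wR.
  by split; rewrite disjoint_subset; apply/subsetP => z /set2P[] ->; rewrite !inE //
    ?negb_or ?vR ?vS ?wR ?wS.
have WD v : v \notin W -> v \in R -> v \in D.
  by rewrite !inE !negb_or => /andP[/andP[-> _] _] ->.
have cD x y : x \in D -> y \in D -> cadj x y -> g x = g y.
  by move=> xD yD /orP[/eqP->//|]; apply: gD.
have key v x : v \notin W -> x \in D -> cadj v x -> L v = g x.
  move=> vW xD vx; have [y [yD vy ->]] := rep v vW.
  have [/(WD v vW) vD|vR] := boolP (v \in R).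
    by rewrite -(cD v y) // (cD v x).
  apply/eqP; apply: contraT => gxy; have [d1 d2] := dW v v vW vW vR vR.
  have : connector g [set v; v].
    by apply/connectorP; exists v, v, y, x; split=> //; exact: cadjxx.
  by move/Mmax; rewrite d2.
have Lonto c : exists2 x, x \notin W & L x = c.
  have [x xD gx] := gonto c; have xW : x \notin W.
    move: (xD); rewrite !inE => /andP[xS xR]; rewrite (negPf xS) (negPf (MD x xD)) orbF /=.
    by apply/subsetPn; exists x; rewrite // inE mem_nbh1 cadjxx.
  by exists x => //; rewrite (key x x) // cadjxx.
have Ledge x y : x \notin W -> y \notin W -> e x y -> L x = L y.
  move=> xW yW xy; have cxy : cadj x y by rewrite /cadj xy orbT.
  have [/(WD x xW) xD|xR] := boolP (x \in R).
    by rewrite (key x x) ?cadjxx // (key y x) // cadj_sym.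
  have [/(WD y yW) yD|yR] := boolP (y \in R).
    by rewrite (key y y) ?cadjxx // (key x y).
  have [x' [xD' xx' ->]] := rep x xW; have [y' [yD' yy' ->]] := rep y yW.
  apply/eqP; apply: contraT => gxy; have [d1 d2] := dW x y xW yW xR yR.
  have : connector g [set x; y] by apply/connectorP; exists x, y, x', y'.
  by move/Mmax; rewrite d2.
have := toughT k1 Ledge Lonto.
have WW : #|W| <= #|S| + #|trapped R S| + 2 * #|M|.
  rewrite /W; apply: leq_trans (leq_card_setU _ _) _; apply: leq_add.
    exact: leq_card_setU.
  apply: leq_trans (leq_card_cover M) _; rewrite mulnC -sum_nat_const.
  apply: leq_sum => E /cM/connectorP[v [w [_ [_ [-> _ _ _]]]]].
  by rewrite cards2; case: eqP.
rewrite -ME; nia.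
Qed.

(** Karger's contraction argument.  There are at least Th N disjoint connectors of
    [h], and a coarser labelling with at most Th U connectors is constant across
    all but Th U of them.  Averaging, some connector can be contracted while
    keeping a fraction (N - U) / N of these labellings; the product of these
    fractions down to U labels is 1 / 'C(N, U). *)
Lemma few_cuts N (h : V -> 'I_N) k U : labelling h -> 0 < Th -> #|S| < U -> U <= N ->
  #|[set g : {ffun 'I_N -> 'I_k} | packnum (g \o h) <= Th * U]| <= 'C(N, U) * k ^ U.
Proof.
move=> + Th0 SU; elim: N h => [|N IH] h hV UN.
  by move: UN; rewrite leqn0 => /eqP U0; rewrite U0 in SU.
move: UN; rewrite leq_eqVlt => /orP[/eqP->|UN].
  by rewrite binn mul1n -[X in k ^ X]card_ord -[X in X ^ _]card_ord -card_ffun max_card.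
set F := [set g | _]; set B := 'C(N, U) * k ^ U.
have N1 : 1 < N.+1 by lia.
have [M pM ME] := packnum_attained h.
have Mlb : Th * N.+1 <= #|M| by rewrite ME; apply: packnum_lower_bound => //; lia.
have [tM /forall_inP cM] := andP pM.
have lbg g : g \in F -> #|M| - Th * U <= #|[set E in M | ~~ connector (g \o h) E]|.
  rewrite inE => gU; rewrite leq_subLR.
  apply: (@leq_trans (#|[set E in M | connector (g \o h) E]| + #|[set E in M | ~~ connector (g \o h) E]|)).
    rewrite -(cardsID [set E | connector (g \o h) E] M); apply: leq_add.
      by apply/subset_leq_card/subsetP => E; rewrite !inE.
    by apply/subset_leq_card/subsetP => E; rewrite !inE andbC.
  rewrite leq_add2r; apply: leq_trans gU; apply: packnum_ge; apply/andP; split.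
    by apply: trivIsetS tM; apply/subsetP => E; rewrite inE => /andP[].
  by apply/forall_inP => E; rewrite inE => /andP[].
have ubE E : E \in M -> #|[set g in F | ~~ connector (g \o h) E]| <= B.
  move=> /cM/connectorP[v [w [x [y [EE d vw [xD yD vx wy hxy]]]]]].
  set a := h x in hxy; set b := h y in hxy.
  have [c [c1 c2]] := contract_ord hxy.
  have hV' : labelling (c \o h).
    split=> [s t sD tD st /=|z]; first by rewrite (hV.1 _ _ sD tD st).
    by have [s sD sE] := hV.2 (lift b z); exists s; rewrite //= sE.
  have UN' : U <= N by [].
  apply: leq_trans (IH _ hV' UN'); pose phi (g : {ffun 'I_N.+1 -> 'I_k}) := [ffun z => g (lift b z)].
  set A := [set g in F | _].
  have Aab g : g \in A -> g a = g b.
    rewrite !inE => /andP[_ nc]; apply/eqP; apply: contraR nc => gab.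
    by apply/connectorP; exists v, w, x, y.
  have phic g : g \in A -> forall z, phi g (c z) = g z.
    move=> gA z; rewrite ffunE c2; case: eqP => [->|//]; exact: Aab.
  rewrite -(card_in_imset (f := phi) (D := mem A)); last first.
    by move=> g g' gA gA' gg'; apply/ffunP => z; rewrite -phic // gg' phic.
  apply/subset_leq_card/subsetP => _ /imsetP[g gA ->]; rewrite inE.
  have := gA; rewrite !inE => /andP[gU _]; apply: leq_trans gU; apply: eq_leq.
  by apply: eq_packnum => s t _ _ /=; rewrite !phic.
(* double counting of the pairs of a labelling in F and a connector in M that
   does not cross it *)
have dc : #|F| * (#|M| - Th * U) <= #|M| * B.
  apply: (@leq_trans (\sum_(g in F) \sum_(E in M) (~~ connector (g \o h) E : nat))).
    rewrite -sum_nat_const leq_sum // => g /lbg /leq_trans; apply; rewrite -sum1_card.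
    rewrite big_mkcond /= [leqRHS]big_mkcond /= leq_sum // => E _.
    by rewrite inE; case: (E \in M) => //=; case: connector.
  rewrite exchange_big /= -sum_nat_const leq_sum // => E /ubE; apply: leq_trans.
  rewrite -[leqRHS]sum1_card big_mkcond /= [leqRHS]big_mkcond /= leq_sum // => g _.
  by rewrite !inE; case: (packnum _ <= _) => //=; case: connector.
have goal : (N.+1 - U) * #|F| <= N.+1 * B.
  have [FB|FB] := leqP #|F| B; first by apply: leq_mul => //; apply: leq_subr.
  have h1 : #|M| * #|F| <= #|M| * B + #|F| * (Th * U) by nia.
  have h2 : #|M| * (#|F| - B) <= Th * (#|F| * U) by nia.
  have h3 : Th * (N.+1 * (#|F| - B)) <= Th * (#|F| * U).
    by apply: leq_trans h2; rewrite mulnA leq_mul2r Mlb orbT.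
  rewrite leq_pmul2l // in h3; nia.
rewrite -(leq_pmul2l (m := N.+1 - U)) ?subn_gt0 //; apply: leq_trans goal _.
by rewrite /B !mulnA -[X in _ * 'C(X, _) * _](succnK N) mul_bin_down.
Qed.

End Cuts.
End Toughness.

(** * Random reserves *)

Section Sampling.
Variables (V : finType) (e : rel V).
Hypothesis e_sym : symmetric e.
Variables (T : nat).
Hypothesis toughT : label_tough e T.

Definition indep (Z : {set V}) :=
  [forall x in Z, forall y in Z, (x != y) ==> ~~ e x y].

Lemma indepP (Z : {set V}) :
  reflect {in Z &, forall x y, e x y -> x = y} (indep Z).
Proof.
apply: (iffP forall_inP) => [H x y xZ yZ xy|H x xZ].
  apply/eqP; have /forall_inP/(_ y yZ) := H x xZ; rewrite xy.
  by case: eqP.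
by apply/forall_inP => y yZ; apply/implyP; apply: contra => /(H x y xZ yZ)->.
Qed.

(** Each vertex of [Z] is alone in its component once its neighbours are deleted. *)
Lemma indep_tough (Z : {set V}) : 1 < #|Z| -> indep Z -> T * #|Z| <= #|nbh e Z :\: Z|.
Proof.
move=> Z1 /indepP iZ; have /card_gt0P[z0 z0Z] : 0 < #|Z| by apply: ltnW.
apply: (toughT (lab := fun x => enum_rank_in z0Z (if x \in Z then x else z0))) => //.
- have out x y : x \in Z -> y \notin nbh e Z :\: Z -> e x y -> y \in Z.
    rewrite !inE negb_and negbK => xZ /orP[//|/existsP nN] xy; case: nN.
    by exists x; rewrite xZ /cadj xy orbT.
  move=> x y xW yW xy; have [xZ|xZ] := boolP (x \in Z).
    by have yZ := out x y xZ yW xy; rewrite yZ (iZ x y).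
  have [yZ|//] := boolP (y \in Z).
  by rewrite (out y x) // e_sym in xZ.
move=> c; exists (enum_val c); last by rewrite enum_valP enum_valK_in.
by rewrite inE enum_valP.
Qed.

Lemma indep_nbh (Z : {set V}) : T <= #|V| -> Z != set0 -> indep Z ->
  T * #|Z| <= #|nbh e Z|.
Proof.
move=> TV; rewrite -card_gt0 leq_eqVlt => /orP[/eqP Z1 iZ|Z1 iZ]; last first.
  exact: leq_trans (indep_tough Z1 iZ) (subset_leq_card (subsetDl _ _)).
have /cards1P[v ->] : #|Z| == 1 by rewrite -Z1.
rewrite cards1 muln1.
have [/eqP ->|] := boolP (nbh e [set v] == setT); first by rewrite cardsT.
rewrite -subTset => /subsetPn[w _]; rewrite mem_nbh1 => vw.
apply: (@leq_trans (T * 2)); first by rewrite muln2 -addnn leq_addr.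
apply: (leq_trans _ (subset_leq_card (subsetDl _ [set v]))).
apply: (toughT (lab := fun x => if x == v then ord0 else ord_max)) => //.
- have out y : y \notin nbh e [set v] :\ v -> e v y -> y = v.
    by rewrite in_setD1 mem_nbh1 /cadj negb_and negbK => /orP[/eqP//|+ vy]; rewrite vy orbT.
  move=> x y xW yW xy; case: (eqVneq x v) => [xv|xv].
    by rewrite (out y) ?eqxx // -xv.
  case: (eqVneq y v) => // yv; move: xv; rewrite (out x) ?eqxx //.
  by rewrite -yv e_sym.
- move=> c; have [c0|c1] := boolP (c == ord0).
    by exists v; rewrite ?eqxx ?(eqP c0) // in_setD1 eqxx.
  exists w; first by rewrite in_setD1 mem_nbh1 (negPf vw) andbF.
  case: eqP => [wv|_]; first by rewrite wv cadjxx in vw.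
  by apply/val_inj; case: c c1 => [[|[|c]]].
Qed.

(** The finest labelling: any other one factors through it. *)
Lemma component_labelling (R S : {set V}) x0 : x0 \in R :\: S -> exists N (h : V -> 'I_N),
  [/\ labelling e R S h, N <= #|V| &
      forall k (lab : V -> 'I_k), {in R :\: S &, forall x y, e x y -> lab x = lab y} ->
        {in R :\: S &, forall x y, h x = h y -> lab x = lab y}].
Proof.
set D := R :\: S => x0D; have cs : connect_sym (within e D) by apply: connect_within_sym.
pose rt := [set root (within e D) x | x in D].
have rin x : x \in D -> root (within e D) x \in rt by move=> xD; apply: imset_f.
pose h x := enum_rank_in (rin x0 x0D) (root (within e D) x).
have hE x y : x \in D -> y \in D -> (h x == h y) = connect (within e D) x y.
  move=> xD yD; rewrite -(root_connect cs); apply/eqP/eqP => [|rxy]; last by rewrite /h rxy.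
  by apply: (can_in_inj (enum_rankK_in (rin x0 x0D))); apply/rin.
exists #|rt|, h; split; first split.
- move=> x y xD yD xy; apply/eqP; rewrite hE //; apply: connect1.
  by rewrite /within /= xy xD yD.
- move=> c; have /imsetP[x xD cE] := enum_valP c; exists x => //.
  by rewrite /h -cE enum_valK_in.
- by rewrite max_card.
move=> k lab labD x y xD yD /eqP; rewrite hE // => /connectP[p pP ->].
elim: p x {xD} pP => //= z p IH x /andP[/and3P[xz xD zD] /IH <-].
exact: labD.
Qed.

(** Deleting [S] from the reserve R1 :|: R2 leaves at most max(1, |S|) components
    that meet [R1]. *)
Definition linked (R1 R2 : {set V}) := forall (S : {set V}) k (lab : V -> 'I_k),
  1 < k -> {in (R1 :|: R2) :\: S &, forall x y, e x y -> lab x = lab y} ->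
  (forall c, exists2 x, x \in R1 :\: S & lab x = c) -> k <= #|S|.

(** A failure of [linked] with exactly [k] labels, in a form that is decidable,
    hence defines a set of colourings. *)
Definition unlinked k (R1 R2 S : {set V}) : bool :=
  [exists lab : {ffun V -> 'I_k},
    [forall x in (R1 :|: R2) :\: S, forall y in (R1 :|: R2) :\: S, e x y ==> (lab x == lab y)]
    && [forall c, exists x in R1 :\: S, lab x == c]].

Lemma unlinkedP k (R1 R2 S : {set V}) : reflect
  (exists lab : V -> 'I_k, {in (R1 :|: R2) :\: S &, forall x y, e x y -> lab x = lab y} /\
     forall c, exists2 x, x \in R1 :\: S & lab x = c)
  (unlinked k R1 R2 S).
Proof.
apply: (iffP existsP) => [[lab /andP[/forall_inP H1 /forallP H2]]|[lab [H1 H2]]].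
  exists lab; split=> [x y xD yD xy|c].
    by have /forall_inP/(_ y yD)/implyP/(_ xy)/eqP := H1 x xD.
  by have /exists_inP[x xD /eqP xc] := H2 c; exists x.
exists (finfun lab); apply/andP; split.
  apply/forall_inP => x xD; apply/forall_inP => y yD; apply/implyP => xy.
  by rewrite !ffunE (H1 x y).
by apply/forallP => c; have [x xD xc] := H2 c; apply/exists_inP; exists x; rewrite // ffunE xc.
Qed.

(** Labels can be merged, so it is enough to exclude labellings with the least
    number of labels exceeding max(1, |S|). *)
Lemma not_unlinked_linked (R1 R2 : {set V}) :
  (forall S : {set V}, ~~ unlinked (maxn 1 #|S|).+1 R1 R2 S) -> linked R1 R2.
Proof.
move=> nf S k lab k1 labD labo; rewrite leqNgt; apply/negP => Sk.
have /negP := nf S; apply; set m := maxn 1 #|S|; have mk : m < k by rewrite gtn_max k1.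
apply/unlinkedP; exists (fun x => inord (minn (lab x) m)); split.
  by move=> x y xD yD xy; rewrite (labD x y).
move=> c; have ck : c < k by apply: leq_ltn_trans mk; rewrite -ltnS.
have [x xD xc] := labo (Ordinal ck); exists x => //; rewrite xc /=.
have cm : c <= m by rewrite -ltnS.
by rewrite (minn_idPl cm) inord_val.
Qed.

Variable C : finType.
Implicit Type f : {ffun V -> C}.
Definition colour_class f (i : C) : {set V} := [set v | f v == i].

Variables (l X Th : nat).
Hypothesis nl : #|V| < 2 ^ l.
Hypothesis TTh : 4 * Th <= T.
Hypothesis XTh : X.+1 <= 2 * Th.
Hypothesis ThC : #|C| ^ 2 * (10 * l) <= Th.
Hypothesis C0 : 0 < #|C|.
Hypothesis l0 : 0 < l.

(** With the class [A] of colour [i] fixed, a failure gives a labelling lab of the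
    components of A :\: S none of whose connectors lies in the class of [j].  Let
    u Th be the number of disjoint connectors of lab, up to rounding.  There are at
    most 2 ^ (2 l (u + 1)) such labellings by [few_cuts], each avoided by the class
    of [j] with probability at most 2 ^ (- 10 l u); and u > |S| by
    [packnum_lower_bound]. *)
Lemma unlinked_rare_fixed i j (A S : {set V}) : i != j -> #|trapped e A S| <= X * #|S| ->
  #|[set f | (colour_class f i == A) && unlinked (maxn 1 #|S|).+1 A (colour_class f j) S]|
     * 2 ^ (l * (#|S| + 5)) <= #|[set f | colour_class f i == A]|.
Proof.
move=> ij badS; set EA := [set f | colour_class f i == A]; set B := [set f | _]; set m := maxn 1 #|S|.
have [/eqP D0|] := boolP (A :\: S == set0).
  suff -> : B = set0 by rewrite cards0.
  apply/setP => f; rewrite !inE; apply/negP => /andP[_ /unlinkedP[lab [_ /(_ ord0)[x]]]].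
  by rewrite D0 inE.
case/set0Pn => x0 x0D; have [N [h [hV NV hU]]] := component_labelling x0D.
have Th0 : 0 < Th.
  by apply: leq_trans ThC; rewrite !muln_gt0 C0 l0.
have Sm : #|S| <= m.+1 by rewrite (leq_trans _ (leqnSn _)) // leq_maxr.
pose cv (g : {ffun 'I_N -> 'I_m.+1}) := packnum e A S (g \o h).
(* the colourings for which lab can be the coarsening of h by g *)
pose avoids (g : {ffun 'I_N -> 'I_m.+1}) :=
  [set f in EA | [forall M, packs e A S (g \o h) M ==> [forall E in M, ~~ mono f E j]]].
pose F (u : 'I_#|V|.+1) := \bigcup_(g : {ffun 'I_N -> 'I_m.+1} | (cv g %/ Th == u) && (m < u)) avoids g.
have BF : B \subset \bigcup_u F u.
  apply/subsetP => f; rewrite inE => /andP[fA /unlinkedP[lab [lab1 lab2]]].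
  have DR x : x \in A :\: S -> x \in (A :|: colour_class f j) :\: S.
    by rewrite !inE => /andP[-> ->].
  have lab1' : {in A :\: S &, forall x y, e x y -> lab x = lab y}.
    by move=> x y /DR xD /DR yD; apply: lab1.
  have labh := hU _ lab lab1'.
  have /fin_all_exists[pre preP] : forall c : 'I_N, exists x, x \in A :\: S /\ h x = c.
    by move=> c; have [x xD xc] := hV.2 c; exists x.
  pose g : {ffun 'I_N -> 'I_m.+1} := [ffun c => lab (pre c)].
  have gh x : x \in A :\: S -> g (h x) = lab x.
    by move=> xD; rewrite ffunE; have [pD pE] := preP (h x); apply: labh.
  have gV : labelling e A S (g \o h).
    split=> [x y xD yD xy /=|c]; first by rewrite !gh //; apply: lab1'.
    by have [x xD xc] := lab2 c; exists x => //=; rewrite gh.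
  have cvm : Th * m.+1 <= cv g.
    by apply: (packnum_lower_bound e_sym toughT TTh XTh badS) => //; rewrite ltnS leq_maxl.
  have cvV : cv g <= #|V|.
    have [M /andP[tM /forall_inP cM] ME] := packnum_attained e A S (g \o h).
    rewrite /cv -ME.
    apply: leq_trans (max_card (mem (cover M))); rewrite -(eqP tM) -sum1_card.
    apply: leq_sum => E /cM/connectorP[v [w [_ [_ [-> _ _ _]]]]].
    by rewrite card_gt0; apply/set0Pn; exists v; rewrite !inE eqxx.
  have uV : cv g %/ Th < #|V|.+1 by rewrite ltnS (leq_trans (leq_div _ _)).
  apply/bigcupP; exists (Ordinal uV) => //; apply/bigcupP; exists g.
    by rewrite eqxx /= leq_divRL // mulnC.
  rewrite inE inE fA /=; apply/forallP => M; apply/implyP => /andP[_ /forall_inP cM].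
  apply/forall_inP => E /cM/connectorP[v [w [x [y [-> d vw [xD yD vx wy]]]]]].
  rewrite /= !gh //; apply: contra => /subsetP mE.
  have inR z : z \in [set v; w] -> z \in (A :|: colour_class f j) :\: S.
    move=> zE; have := mE z zE; rewrite !inE => ->.
    have /pred0P/(_ z) := d; rewrite /= zE !inE => /negbT; rewrite negb_or => /andP[_ ->].
    by rewrite orbT.
  have vR := inR v (set21 _ _); have wR := inR w (set22 _ _).
  have lc s t : s \in (A :|: colour_class f j) :\: S -> t \in (A :|: colour_class f j) :\: S ->
    cadj e s t -> lab s = lab t by move=> sD tD /orP[/eqP->//|]; apply: lab1.
  by rewrite -(lc v x vR (DR x xD) vx) (lc v w vR wR vw) (lc w y wR (DR y yD) wy).
rewrite -/(#|B|); apply: leq_trans (_ : #|\bigcup_u F u| * 2 ^ (l * (#|S| + 5)) <= _).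
  by rewrite leq_mul2r (subset_leq_card BF) orbT.
apply: (union_bound (b := l)); first by rewrite card_ord.
move=> u; have [mu|um] := ltnP m u; last first.
  suff -> : F u = set0 by rewrite cards0.
  by apply: big1 => g; rewrite ltnNge um andbF.
have avr g : cv g %/ Th = u -> #|avoids g| * 2 ^ (10 * l * u) <= #|EA|.
  move=> gu; have [M pM ME] := packnum_attained e A S (g \o h).
  have [tM /forall_inP cM] := andP pM.
  apply: leq_trans (_ : #|[set f in EA | [forall E in M, ~~ mono f E j]]| * 2 ^ (10 * l * u) <= _).
    rewrite leq_mul2r; apply/orP; right; apply/subset_leq_card/subsetP => f.
    rewrite /avoids inE => /andP[fE /forallP/(_ M)/implyP/(_ pM) fM].
    by rewrite inE fE fM.
  apply: (avoid_rare (h := 2)) => //.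
  - move=> E /cM/connectorP[v [w [_ [_ [-> _ _ _]]]]].
    by rewrite cards2; case: eqP.
  - move=> f E; rewrite !inE => /eqP fA /cM/connectorP[v [w [_ [_ [_ d _ _]]]]].
    apply/eqP/setP => z; rewrite inE ffunE; case: ifP => zE; last by rewrite -fA inE.
    have /pred0P/(_ z) := d; rewrite /= zE /= inE => /negbT; rewrite negb_or => /andP[/negPf-> _].
    by rewrite eq_sym (negPf ij).
  - rewrite ME -/(cv g) mulnA; apply: leq_trans (leq_trunc_div (cv g) Th).
    by rewrite gu mulnC leq_mul2l ThC orbT.
have cnt : #|[set g : {ffun 'I_N -> 'I_m.+1} | cv g %/ Th == u]| <= 2 ^ (2 * l * u.+1).
  have m2 : m.+1 <= 2 ^ l.
    apply: leq_trans nl; rewrite ltnS geq_max max_card andbT.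
    by apply/card_gt0P; exists x0.
  have N2 : N <= 2 ^ l by apply: leq_trans NV (ltnW nl).
  have [NU|UN] := leqP N u.+1.
    apply: leq_trans (max_card _) _; rewrite card_ffun !card_ord.
    apply: (@leq_trans ((2 ^ l) ^ N)); first by case: (N) => // N'; rewrite leq_exp2r.
    rewrite -expnM leq_pexp2l //; nia.
  have [x _ _] := hV.2 (Ordinal UN).
  have Su : #|S| < u.+1 by rewrite ltnS (leq_trans _ (ltnW mu)) // leq_maxr.
  have := few_cuts e_sym toughT TTh XTh badS m.+1 hV Th0 Su (ltnW UN).
  move=> H; apply: leq_trans (leq_trans _ H) _.
    apply/subset_leq_card/subsetP => g; rewrite !inE => /eqP gu.
    by rewrite -/(cv g) mulnC -gu ltnW // ltn_ceil.
  have -> : 2 * l * u.+1 = l * u.+1 + l * u.+1 by lia.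
  rewrite expnD !expnM; apply: leq_mul; last by rewrite leq_exp2r.
  by apply: leq_trans (bin_leq_expn _ _) _; rewrite leq_exp2r.
have Fu : #|F u| * 2 ^ (10 * l * u) <= 2 ^ (2 * l * u.+1) * #|EA|.
  apply: (leq_trans (leq_mul (card_bigcup_le _ _) (leqnn _))); rewrite big_distrl /=.
  apply: (@leq_trans (\sum_(g : {ffun 'I_N -> 'I_m.+1} | (cv g %/ Th == u) && (m < u)) #|EA|)).
    by apply: leq_sum => g /andP[/eqP gu _]; apply: avr.
  rewrite sum_nat_const leq_mul2r; apply/orP; right; apply: leq_trans cnt.
  by apply/subset_leq_card/subsetP => g; rewrite !inE => /andP[].
rewrite -(leq_pmul2l (m := 2 ^ (2 * l * u.+1))) ?expn_gt0 //.
apply: leq_trans Fu; rewrite mulnCA -expnD leq_mul2l leq_exp2l //.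
have Su : #|S| < u by rewrite (leq_ltn_trans _ mu) // leq_maxr.
have u1 : 1 < u by rewrite (leq_ltn_trans _ mu) // leq_maxl.
(* 10 u >= 2 (u + 1) + 1 + (#|S| + 5), where 1 pays for the summation over u *)
apply/orP; right; nia.
Qed.

Lemma unlinked_rare i j (S : {set V}) : i != j ->
  #|[set f | (#|trapped e (colour_class f i) S| <= X * #|S|) &&
       unlinked (maxn 1 #|S|).+1 (colour_class f i) (colour_class f j) S]|
     * 2 ^ (l * (#|S| + 5)) <= #|{ffun V -> C}|.
Proof.
move=> ij; set B := [set f | _].
rewrite -sum1_card (partition_big (fun f => colour_class f i) predT) //= big_distrl /=.
rewrite -[leqRHS]sum1_card (partition_big (fun f => colour_class f i) predT) //=.
apply: leq_sum => A _; rewrite !sum1dep_card.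
have [badS|badS] := leqP #|trapped e A S| (X * #|S|); last first.
  rewrite (_ : [set f | _] = set0) ?cards0 //; apply/setP => f; rewrite !inE.
  by apply/negP => /andP[/andP[+ _] /eqP fA]; rewrite fA leqNgt badS.
apply: leq_trans (unlinked_rare_fixed ij badS); rewrite leq_mul2r; apply/orP; right.
by apply/subset_leq_card/subsetP => f; rewrite !inE => /andP[/andP[_ +] /eqP fA]; rewrite fA eqxx.
Qed.

Variable Y : nat.
Hypothesis YC : #|C| * (5 * l) <= Y.
Hypothesis XY : 2 * Y < X.
Hypothesis TY : Y < T.
Hypothesis TV : T <= #|V|.

(** If many vertices are trapped, then some independent set [Z] of at most |S| + 1
    trapped vertices has a large neighbourhood: a maximal independent set
    dominates all trapped vertices, and if it is too large, any |S| + 1 of its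
    elements have many neighbours by toughness.  The class of [i] must miss this
    neighbourhood outside [S], which is unlikely enough for a union bound over
    [S] and [Z]. *)
Lemma trapped_rare i (S : {set V}) :
  #|[set f | X * #|S| < #|trapped e (colour_class f i) S|]| * 2 ^ (l * (4 * #|S| + 3))
    <= #|{ffun V -> C}|.
Proof.
set B := [set f | _]; set s := #|S|.
pose F (Z : {set V}) := if (#|Z| <= s.+1) && (s.+1 * Y <= #|nbh e Z :\: S|)
  then [set f in setT | [forall E in [set [set v] | v in nbh e Z :\: S], ~~ mono f E i]] else set0.
have FZ (Z : {set V}) : #|F Z| * 2 ^ (l * (#|Z| + (4 * s + 3).+1)) <= #|{ffun V -> C}|.
  rewrite /F; case: ifP => [/andP[Zs Ys]|_]; last by rewrite cards0.
  apply: (@leq_trans (#|[set f in setT | [forall E in [set [set v] | v in nbh e Z :\: S], ~~ mono f E i]]| * 2 ^ (5 * l * s.+1))).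
    (* 5 (s + 1) >= #|Z| + 4 (s + 1) *)
    rewrite leq_mul2l leq_exp2l //; apply/orP; right; nia.
  apply: leq_trans (max_card (mem [set: {ffun V -> C}])); apply: (avoid_rare (h := 1)) => //.
  - apply/trivIsetP => _ _ /imsetP[v _ ->] /imsetP[w _ ->] vw.
    by rewrite disjoints1 inE; apply: contra vw => /eqP->.
  - by move=> _ /imsetP[v _ ->]; rewrite cards1.
  - rewrite card_imset; last exact: set1_inj.
    rewrite expn1 mulnA; apply: leq_trans Ys; rewrite mulnC leq_mul2l; apply/orP; right; exact: YC.
have BF : B \subset \bigcup_Z F Z.
  apply/subsetP => f; rewrite inE -/s => fB; set bd := trapped e (colour_class f i) S in fB.
  pose P (Z : {set V}) := indep Z && (Z \subset bd).
  have P0 : P set0 by rewrite /P sub0set andbT; apply/indepP => x y; rewrite inE.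
  case: (@arg_maxnP _ set0 P (fun Z : {set V} => #|Z|) P0) => I /andP[iI Ib] Imax.
  have bI : bd \subset nbh e I.
    apply/subsetP => v vb; rewrite inE; apply/existsP.
    have [vI|vI] := boolP (v \in I); first by exists v; rewrite vI cadjxx.
    have [x /andP[xI xv]|nx] := pickP [pred x in I | cadj e x v].
      by exists x; rewrite xI.
    have /Imax /= : P (v |: I).
      rewrite /P subUset sub1set vb Ib !andbT; apply/indepP => x y.
      have nI x' : x' \in I -> ~~ e x' v.
        by move=> xI; have := nx x'; rewrite /= xI /cadj => /negbT; rewrite negb_or => /andP[].
      case/setU1P=> [->|xI] /setU1P[->|yI] // xy.
      - by have := nI _ yI; rewrite e_sym xy.
      - by have := nI _ xI; rewrite xy.
      - exact: (indepP _ iI).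
    by rewrite cardsU1 vI ltnn.
  have [Z [ZI Zs ZY]] : exists Z : {set V}, [/\ Z \subset I, #|Z| <= s.+1 & s.+1 * Y <= #|nbh e Z :\: S|].
    have nS Z : #|nbh e Z| - s <= #|nbh e Z :\: S|.
      by rewrite cardsD leq_sub2l // subset_leq_card // subsetIr.
    have [Is|Is] := leqP s.+1 #|I|.
      have [Z ZI Zs] : exists2 Z : {set V}, Z \subset I & #|Z| = s.+1.
        exists [set x in take s.+1 (enum I)].
          by apply/subsetP => x; rewrite inE => /mem_take; rewrite mem_enum.
        rewrite cardsE; have /card_uniqP -> : uniq (take s.+1 (enum I)) by rewrite take_uniq // enum_uniq.
        by rewrite size_takel // -cardE.
      exists Z; rewrite ZI Zs leqnn; split=> //; apply: leq_trans (nS Z).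
      have iZ : indep Z.
        by apply/indepP => x y /(subsetP ZI) xI /(subsetP ZI) yI; apply: (indepP _ iI).
      have := indep_nbh TV _ iZ; rewrite -card_gt0 Zs => /(_ isT).
      nia.
    exists I; split=> //; first exact: ltnW.
    apply: leq_trans (nS I); have := subset_leq_card bI.
    have [s0|s0] := posnP s; last by nia.
    move: Is; rewrite s0 ltnS leqn0 cards_eq0 => /eqP I0; rewrite I0.
    suff -> : nbh e set0 = set0 by rewrite cards0; move: fB; lia.
    by apply/setP => v; rewrite !inE; apply/existsP => -[x]; rewrite inE.
  apply/bigcupP; exists Z => //; rewrite /F Zs ZY inE in_setT /=.
  apply/forall_inP => _ /imsetP[v vN ->]; rewrite /mono sub1set inE.
  move: vN; rewrite !inE => /andP[vS /existsP[z /andP[zZ zv]]]; apply: contra vS => vi.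
  have := subsetP Ib z (subsetP ZI z zZ); rewrite inE => /subsetP; apply.
  by rewrite inE mem_nbh1 zv inE.
apply: leq_trans (union_bound_sets nl FZ).
by rewrite leq_mul2r (subset_leq_card BF) orbT.
Qed.

Hypothesis Cl : #|C| <= 2 ^ l.
Hypothesis l2 : 1 < l.

Theorem good_colouring : exists f : {ffun V -> C},
  (forall i (S : {set V}), #|trapped e (colour_class f i) S| <= X * #|S|) /\
  (forall i j, i != j -> linked (colour_class f i) (colour_class f j)).
Proof.
set N := #|{ffun V -> C}|.
pose BA := \bigcup_(i : C) \bigcup_(S : {set V}) [set f | X * #|S| < #|trapped e (colour_class f i) S|].
pose BB (ij : C * C) (S : {set V}) := if ij.1 == ij.2 then set0 else
  [set f | (#|trapped e (colour_class f ij.1) S| <= X * #|S|) &&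
       unlinked (maxn 1 #|S|).+1 (colour_class f ij.1) (colour_class f ij.2) S].
pose BC := \bigcup_(ij : C * C) \bigcup_S BB ij S.
have hA : #|BA| * 2 ^ l <= N.
  apply: (union_bound Cl) => i; rewrite addnn -muln2.
  apply: (union_bound_sets nl) => S; apply: leq_trans (trapped_rare i S).
  rewrite leq_mul2l leq_exp2l // leq_mul2l; apply/orP; right; lia.
have hC : #|BC| * 2 ^ l <= N.
  apply: (union_bound (b := l * 2)).
    by rewrite card_prod expnM -mulnn leq_mul.
  move=> [i j]; rewrite -mulnSr; apply: (union_bound_sets nl) => S.
  rewrite /BB /=; case: eqVneq => [_|ij]; first by rewrite cards0.
  apply: leq_trans (unlinked_rare S ij).
  rewrite leq_mul2l leq_exp2l // leq_mul2l; apply/orP; right; lia.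
have N0 : 0 < N by rewrite /N card_ffun expn_gt0 C0.
(* the two bad events have probability at most 2 ^ - l each *)
have l4 : 2 ^ 2 <= 2 ^ l by rewrite leq_exp2l.
have : ~~ (setT \subset BA :|: BC).
  apply/negP => /subset_leq_card; rewrite cardsT -/N => H.
  have := leq_trans H (leq_card_setU _ _); nia.
case/subsetPn => f _; rewrite in_setU negb_or => /andP[fA fC]; exists f.
have good i (S : {set V}) : #|trapped e (colour_class f i) S| <= X * #|S|.
  rewrite leqNgt; apply: contra fA => fA; apply/bigcupP; exists i => //.
  by apply/bigcupP; exists S => //; rewrite inE.
split=> // i j ij; apply: not_unlinked_linked => S; apply: contra fC => fF.
apply/bigcupP; exists (i, j) => //; apply/bigcupP; exists S => //.
by rewrite /BB /= (negPf ij) inE good.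
Qed.

End Sampling.

(** * Junctions through a reserve *)

Section Linking.
Variables (V : finType) (e : rel V).
Hypothesis e_sym : symmetric e.
Variables (R1 R2 : {set V}) (X : nat).
Let R := R1 :|: R2.
Hypothesis linkR : linked e R1 R2.
Hypothesis badR : forall S : {set V}, #|trapped e R1 S| <= X * #|S|.

Section Links.
Variables (I : finType) (A : {set I}) (Xs : I -> {set V}).
Hypothesis disXs : {in A &, forall a b, a != b -> [disjoint Xs a & Xs b]}.
Hypothesis cardXs : {in A, forall a, X < #|Xs a|}.
Hypothesis XsR : {in A, forall a, [disjoint Xs a & R]}.

Definition touch a u := [&& a \in A, u \in R & [exists x in Xs a, e x u]].

(** The reserve together with one extra vertex for each set [Xs a], so that
    [packing] applies with these extra vertices as terminals. *)
Definition link_rel : rel (V + I) := fun s t => match s, t with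
  | inl u, inl v => [&& e u v, u \in R & v \in R]
  | inl u, inr a => touch a u
  | inr a, inl u => touch a u
  | inr _, inr _ => false
  end.

Lemma link_rel_sym : symmetric link_rel.
Proof.
move=> [u|a] [v|b] //=; rewrite e_sym; congr (_ && _); exact: andbC.
Qed.

(** On a path between two terminals of a block, stop at the first terminal. *)
Lemma extract_link (Q : {set V + I}) : conn link_rel Q ->
  1 < #|Q :&: inr @: A| -> exists a b x y q,
  [/\ [/\ a != b, a \in A, b \in A, inr a \in Q & inr b \in Q],
      x \in Xs a, y \in Xs b,
      uniq q /\ path e x (rcons q y) &
      {in q, forall z, z \in R /\ inl z \in Q}].
Proof.
move=> cQ /card_gt1P[s [t [sQT tQT st]]].
have [sQ /imsetP[a aA sE]] := setIP sQT; have [tQ /imsetP[b0 bA tE]] := setIP tQT.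
subst s t.
have [p [pP pQ up lp]] := conn_spath cQ sQ tQ.
pose isr (s : V + I) := if s is inr _ then true else false.
have hasr : has isr p.
  apply/hasP; exists (inr b0) => //; have := mem_last (inr a) p.
  by rewrite lp inE eq_sym (negPf st).
have [p1 [[u|b] [p2 [pE //= _ nr]]]] := split_first hasr.
have [q qE] : exists q : seq V, p1 = map inl q.
  elim: p1 nr {pE} => [|[u|//] p1 IH] /=; first by exists [::].
  by move=> /IH[q ->]; exists (u :: q).
have inQ s : s \in p -> s \in Q by move=> sp; apply: pQ; rewrite inE sp orbT.
have bQ : inr b \in Q by apply: inQ; rewrite pE mem_cat inE eqxx orbT.
have ab : a != b.
  move: up; rewrite pE cons_uniq mem_cat inE !negb_or => /andP[/and3P[_ + _] _].
  by apply: contra => /eqP->.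
have qQ z : z \in q -> inl z \in Q.
  by move=> zq; apply: inQ; rewrite pE qE mem_cat map_f.
have uq : uniq q.
  move: up; rewrite pE cons_uniq cat_uniq qE => /and3P[_ + _].
  by rewrite map_inj_uniq //; exact: inl_inj.
have: path link_rel (inr a) (rcons (map inl q) (inr b)).
  by move: pP; rewrite pE qE -cat_rcons cat_path => /andP[].
case: q {qE} qQ uq => [_ _ //|u q qQ uq] /=; rewrite rcons_path => /and3P[tu pq tl].
case/and3P: (tu) => _ uR /exists_inP[x xa xu].
move: tl; rewrite last_map => /and3P[bA' lR /exists_inP[y yb yl]].
have [eq qR] : path e u q /\ all (mem R) q.
  elim: q u pq {uq qQ xu tu lR yl uR} => //= v q IH u /andP[/and3P[uv _ vR] /IH[-> ->]].
  by rewrite uv vR.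
exists a, b, x, y, (u :: q); split=> //.
  by split=> //=; rewrite xu rcons_path eq e_sym yl.
move=> z; rewrite inE => /orP[/eqP->|zq]; first by rewrite uR qQ ?inE ?eqxx.
have zR : z \in R := allP qR z zq.
by rewrite zR qQ // inE zq orbT.
Qed.

(** Let [S] be the hubs given by [packing].  The terminals that [S] leaves separated
    define a labelling of the reserve outside [S], each vertex getting the terminal
    it is reachable from; so [linked] bounds their number.  The exception are the
    terminals whose set [Xs a] is trapped entirely, and there are at most |S| of
    these since |Xs a| > X. *)
Lemma links : exists F : {set {set V + I}},
  [/\ trivIset F, #|A| <= 5 * #|F| + 1 & forall Q, Q \in F -> exists a b x y q,
  [/\ [/\ a != b, a \in A, b \in A, inr a \in Q & inr b \in Q],
      x \in Xs a, y \in Xs b,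
      uniq q /\ path e x (rcons q y) &
      {in q, forall z, z \in R /\ inl z \in Q}]].
Proof.
have [F [S [O [tF cF SF [OT TO OS Odis]]]]] := packing link_rel_sym (inr @: A).
exists F; split=> //; last by move=> Q /cF[cQ]; apply: extract_link.
have injr : injective (@inr V I) by move=> ? ? [].
rewrite card_imset // in TO.
pose SV := [set v | inl v \in S]; pose OA := [set a | inr a \in O].
have SVF : #|SV| <= #|F|.
  apply: leq_trans SF; rewrite -(card_imset (mem SV) (@inl_inj V I)).
  by apply/subset_leq_card/subsetP => _ /imsetP[v + ->]; rewrite inE.
have OAA : OA \subset A.
  by apply/subsetP => a; rewrite inE => /(subsetP OT)/imsetP[b bA [->]].
have OE : #|O| = #|OA|.
  rewrite -(card_imset (mem OA) injr); apply: eq_card => s; apply/idP/imsetP => [sO|[a + ->]].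
    by have /imsetP[a aA sE] := subsetP OT s sO; exists a; rewrite // inE -sE.
  by rewrite inE.
(* disjoint sets of more than X vertices each, inside at most X #|SV| vertices *)
pose bads := [set a in OA | Xs a \subset trapped e R1 SV].
have cbads : #|bads| <= #|SV|.
  have tb : trivIset (Xs @: bads).
    apply/trivIsetP => _ _ /imsetP[a + ->] /imsetP[b + ->] ab; rewrite !inE => /andP[aO _] /andP[bO _].
    apply: disXs; rewrite ?(subsetP OAA) ?inE //; by apply: contraNneq ab => ->.
  have inj : {in bads &, injective Xs}.
    move=> a b; rewrite !inE => /andP[aO _] /andP[bO _] eX; apply/eqP; apply: contraT => ab.
    have aA : a \in A by rewrite (subsetP OAA) ?inE.
    have bA : b \in A by rewrite (subsetP OAA) ?inE.
    have := disXs aA bA ab; rewrite eX -setI_eq0 setIid => /eqP X0.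
    by have := cardXs bA; rewrite X0 cards0.
  have : X.+1 * #|bads| <= #|trapped e R1 SV|.
    apply: leq_trans (_ : #|cover (Xs @: bads)| <= _).
      rewrite -(eqP tb) big_imset //= mulnC -sum_nat_const leq_sum // => a.
      by rewrite !inE => /andP[aO _]; apply: cardXs; rewrite (subsetP OAA) ?inE.
    apply/subset_leq_card/bigcupsP => _ /imsetP[a + ->].
    by rewrite inE => /andP[].
  have := badR SV; nia.
pose G := OA :\: bads.
have cG : #|OA| <= #|G| + #|SV|.
  by rewrite -(cardsID bads OA) addnC leq_add2l (leq_trans _ cbads) // subset_leq_card // subsetIr.
suff Gb : #|G| <= maxn 1 #|SV|.
  have arith a o g sv f : a <= o + 3 * f -> o <= g + sv -> g <= maxn 1 sv -> sv <= f ->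
    a <= 5 * f + 1 by lia.
  by rewrite OE in TO; apply: arith TO cG Gb SVF.
have [G1|G1] := leqP #|G| 1; first by rewrite leq_max G1.
rewrite leq_max; apply/orP; right.
have /card_gt0P[a0 a0G] : 0 < #|G| by apply: ltnW.
pose cn a v := connect (within link_rel (~: S)) (inr a) (inl v).
pose lab v := enum_rank_in a0G (odflt a0 [pick a in G | cn a v]).
have RI v : v \in R :\: SV -> v \in R /\ inl v \in ~: S.
  by rewrite in_setD in_setC !inE => /andP[].
apply: (linkR (lab := lab)) => //.
  move=> u v /RI[uR uS] /RI[vR vS] uv; congr (enum_rank_in a0G (odflt a0 _)).
  apply: eq_pick => a /=; congr (_ && _).
  have cuv : connect (within link_rel (~: S)) (inl u) (inl v).
    by apply: connect1; rewrite /within /= uv uR vR uS vS.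
  apply/idP/idP => [h|h]; first exact: connect_trans h cuv.
  by apply: connect_trans h _; rewrite (connect_within_sym link_rel_sym).
move=> c; set a := enum_val c; have aG : a \in G by apply: enum_valP.
have [aO aB] : a \in OA /\ a \notin bads by move: aG; rewrite inE => /andP[].
have aA := subsetP OAA a aO.
have : ~~ (Xs a \subset trapped e R1 SV) by move: aB; rewrite inE aO.
case/subsetPn => x xa; rewrite inE => /subsetPn[y].
rewrite inE mem_nbh1 => /andP[xy yR1] yS.
have yR : y \in R by rewrite inE yR1.
have {}xy : e x y.
  case/orP: xy => // /eqP xy; have /pred0P/(_ x) := XsR aA.
  by rewrite /= xa xy yR.
have cay : cn a y.
  apply: connect1; rewrite /within /=; apply/and3P; split.
  - by rewrite /touch aA yR; apply/exists_inP; exists x.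
  - rewrite inE; have : inr a \in O by move: aO; rewrite inE.
    by move=> aO'; have := OS; rewrite disjoint_subset => /subsetP/(_ _ aO'); rewrite inE.
  - by move: yS; rewrite !inE.
exists y; first by rewrite inE yS yR1.
rewrite /lab; case: pickP => [b /andP[bG cb]|/(_ a)]; last by rewrite aG cay.
suff -> : b = a by rewrite /= enum_valK_in.
apply/eqP; apply: contraT => ba; have bO : b \in OA by move: bG; rewrite inE => /andP[].
rewrite inE in bO; rewrite inE in aO.
have ne : inr b != inr a :> V + I by apply: contra ba => /eqP[->].
have /negP := Odis _ _ bO aO ne; case; apply: connect_trans cb _.
by rewrite (connect_within_sym link_rel_sym).
Qed.
End Links.

Definition traces (B : {set V}) (p : seq V) := [/\ sorted e p, uniq p & B = [set z in p]].

(** Two paths, each cut at its junction vertex, are joined through [q]. *)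
Lemma splice (p p' q : seq V) x y : sorted e p -> sorted e p' -> uniq p -> uniq p' ->
  x \in p -> y \in p' -> uniq q -> path e x (rcons q y) ->
  {in p, forall z, z \notin p'} -> {in q, forall z, z \notin p /\ z \notin p'} ->
  exists s, [/\ sorted e s, uniq s &
    s =i rev (drop (index x p) p) ++ q ++ drop (index y p') p'].
Proof.
move=> sp sp' up up' xp yp uq ep dp dq.
set s1 := drop _ p; set s2 := drop _ p'.
have [t1 s1E] : exists t, s1 = x :: t.
  by exists (drop (index x p).+1 p); rewrite /s1 (drop_nth x) ?index_mem // nth_index.
have [t2 s2E] : exists t, s2 = y :: t.
  by exists (drop (index y p').+1 p'); rewrite /s2 (drop_nth y) ?index_mem // nth_index.
have S1 : sorted e s1 by apply: drop_sorted.
have S2 : sorted e s2 by apply: drop_sorted.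
exists (rev s1 ++ q ++ s2); split=> //.
- have -> : rev s1 ++ q ++ s2 = rev t1 ++ x :: (rcons q y ++ t2).
    by rewrite s1E s2E rev_cons cat_rcons cat_rcons.
  have : sorted e (rcons (rev t1) x).
    rewrite -rev_cons rev_sorted -s1E.
    by rewrite (eq_sorted (e' := e)) // => u v; rewrite e_sym.
  have : path e x (rcons q y ++ t2).
    by rewrite cat_path ep last_rcons; move: S2; rewrite s2E.
  rewrite -cat_rcons; case: (rev t1) => [|z t] //= pw pt.
  by rewrite cat_path last_rcons pt pw.
- rewrite !cat_uniq rev_uniq !drop_uniq // uq /=.
  apply/and3P; split=> //.
    apply/hasPn => z; rewrite mem_cat /= mem_rev => /orP[zq|/mem_drop zp'].
      by have [zp _] := dq z zq; apply: contra zp; apply: mem_drop.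
    by apply: contraL zp' => /mem_drop; apply: dp.
  apply/hasPn => z /mem_drop zp' /=; apply/negP => zq.
  by have [_ /negP] := dq z zq.
Qed.

End Linking.

(** * Merging paths *)

Section Merging.
Variables (V : finType) (e : rel V).
Hypothesis e_sym : symmetric e.

Definition traceable (B : {set V}) : bool :=
  [exists s : #|B|.-tuple V, [&& sorted e s, uniq s & B == [set z in s]]].

Lemma traceableP (B : {set V}) : reflect (exists p, traces e B p) (traceable B).
Proof.
apply: (iffP existsP) => [[s /and3P[? ? /eqP ?]]|[p [sp up BE]]]; first by exists s.
have sB : size p == #|B| by rewrite BE cardsE (card_uniqP up).
by exists (Tuple sB); rewrite sp up -BE eqxx.
Qed.

Lemma traces_size (B : {set V}) p : traces e B p -> size p = #|B|.
Proof. by case=> _ up ->; rewrite cardsE (card_uniqP up). Qed.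

Definition pathsys s0 (P : {set {set V}}) :=
  trivIset P /\ {in P, forall B, traceable B /\ s0 <= #|B|}.

Variables (X K : nat).
Hypothesis K2 : 1 < K.

(** All junctions found by [links] are used at once: they lie in disjoint blocks,
    so each path is used at most once, and only vertices of the sets [Xs B] are
    lost.  With f junctions the number of paths drops by f, and f is at least a
    fifth of the number of paths minus one. *)
Lemma merge_round (R1 R2 : {set V}) s0 (P : {set {set V}}) :
  linked e R1 R2 -> (forall S : {set V}, #|trapped e R1 S| <= X * #|S|) ->
  0 < s0 -> K * X.+1 <= s0 -> pathsys s0 P -> [disjoint cover P & R1 :|: R2] ->
  exists P', [/\ pathsys s0 P', cover P' \subset cover P :|: (R1 :|: R2),
    K * #|cover P| <= K * #|cover P'| + #|V|,
    0 < #|P| -> 0 < #|P'| & 5 * #|P'|.-1 <= 4 * #|P|.-1].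
Proof.
move=> lk bd s00 Ks0 [tP Ps] dPR; set R := R1 :|: R2.
have /fin_all_exists[pth pthP] : forall B : {set V}, exists p, B \in P -> traces e B p.
  move=> B; have [/Ps[/traceableP[p pB] _]|_] := boolP (B \in P); last by exists [::].
  by exists p.
pose Xs (B : {set V}) := [set z in take (#|B| %/ K) (pth B)].
have XsB B : B \in P -> Xs B \subset B.
  move=> /pthP[_ _ BE]; apply/subsetP => z; rewrite inE => /mem_take zp.
  by rewrite BE inE.
have szXs B : B \in P -> #|Xs B| = #|B| %/ K.
  move=> BP; have [_ up BE] := pthP B BP; rewrite cardsE.
  have /card_uniqP -> : uniq (take (#|B| %/ K) (pth B)) by rewrite take_uniq.
  by rewrite size_takel // (traces_size (pthP B BP)) leq_div.
have PR B z : B \in P -> z \in B -> z \notin R.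
  move=> BP zB; apply/negP => zR; have /pred0P/(_ z) := dPR; rewrite /= zR andbT.
  by move/negP; apply; apply/bigcupP; exists B.
have PP B B' z : B \in P -> B' \in P -> z \in B -> z \in B' -> B = B'.
  exact: trivIset_eq tP.
have [|||F [tF PF Fl]] := links e_sym lk bd (A := P) (Xs := Xs).
- move=> B B' BP BP' BB'; apply: disjointW (XsB _ BP) (XsB _ BP') _.
  exact: (trivIsetP tP).
- move=> B BP; rewrite szXs // leq_divRL ?(ltnW K2) // mulnC.
  by apply: leq_trans Ks0 _; have [_] := Ps B BP.
- move=> B BP; rewrite disjoint_subset; apply/subsetP => z /(subsetP (XsB B BP)) zB.
  exact: PR zB.
have : forall Q : {set V + {set V}}, exists abM : {set V} * {set V} * {set V}, Q \in F ->
   let: (a, b, M) := abM in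
   [/\ [/\ a != b, a \in P, b \in P, inr a \in Q & inr b \in Q], traceable M,
     {in M, forall z, [\/ z \in a, z \in b | z \in R /\ inl z \in Q]},
     (a :\: Xs a) \subset M & (b :\: Xs b) \subset M].
  move=> Q; have [/Fl|_] := boolP (Q \in F); last by exists (set0, set0, set0).
  move=> [a [b [x [y [q [[ab aP bP aQ bQ] xa yb [uq pq] qR]]]]]].
  have [sa ua aE] := pthP a aP; have [sb ub bE] := pthP b bP.
  have xa' : x \in pth a by move: xa; rewrite inE => /mem_take.
  have yb' : y \in pth b by move: yb; rewrite inE => /mem_take.
  have ina z : (z \in pth a) = (z \in a) by rewrite [in RHS]aE inE.
  have inb z : (z \in pth b) = (z \in b) by rewrite [in RHS]bE inE.
  have [||s [ss us sE]] := splice e_sym sa sb ua ub xa' yb' uq pq.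
  - move=> z; rewrite ina inb => za; apply: contra ab => zb.
    by rewrite (PP a b z).
  - move=> z /qR[zR _]; rewrite ina inb.
    by split; apply/negP => zz; [have := PR a z aP zz|have := PR b z bP zz]; rewrite zR.
  have keep c z w : c \in P -> traces e c (pth c) -> w \in Xs c -> z \in c :\: Xs c ->
      z \in drop (index w (pth c)) (pth c).
    move=> cP [_ uc cE]; rewrite [w \in _]inE => wX.
    have inc v : (v \in c) = (v \in pth c) by rewrite [in LHS]cE inE.
    rewrite in_setD [z \in Xs c]inE inc => /andP[zX zc].
    move: (zc); rewrite -{1}(cat_take_drop (index w (pth c)) (pth c)) mem_cat => /orP[zt|//].
    have wc := mem_take wX.
    rewrite in_take // in zt; rewrite in_take // in wX.
    by rewrite in_take // (ltn_trans zt wX) in zX.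
  exists (a, b, [set z in s]); move=> _; split=> //.
  - by apply/traceableP; exists s.
  - move=> z; rewrite inE sE !mem_cat mem_rev => /or3P[/mem_drop|/qR|/mem_drop].
    + by rewrite ina; constructor 1.
    + by constructor 3.
    + by rewrite inb; constructor 2.
  - apply/subsetP => z za; rewrite inE sE !mem_cat mem_rev.
    by rewrite (keep a z x).
  - apply/subsetP => z zb; rewrite inE sE !mem_cat mem_rev.
    by rewrite (keep b z y) // !orbT.
case/fin_all_exists => abM HM.
pose fa Q := (abM Q).1.1; pose fb Q := (abM Q).1.2; pose fM Q := (abM Q).2.
have {}HM Q : Q \in F -> [/\ [/\ fa Q != fb Q, fa Q \in P, fb Q \in P,
       inr (fa Q) \in Q & inr (fb Q) \in Q], traceable (fM Q),
     {in fM Q, forall z, [\/ z \in fa Q, z \in fb Q | z \in R /\ inl z \in Q]},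
     (fa Q :\: Xs (fa Q)) \subset fM Q & (fb Q :\: Xs (fb Q)) \subset fM Q].
  by move=> /HM; rewrite /fa /fb /fM; case: (abM Q) => [[]].
have FF Q Q' s : Q \in F -> Q' \in F -> s \in Q -> s \in Q' -> Q = Q'.
  exact: trivIset_eq tF.
(* each vertex of a merged path determines a vertex of the auxiliary graph in its
   block, so that merged paths inherit the disjointness of the blocks *)
pose own z : V + {set V} := if z \in R then inl z else inr (pblock P z).
have ownM Q z : Q \in F -> z \in fM Q -> own z \in Q.
  move=> QF; have [[_ aP bP aQ bQ] _ Mz _ _] := HM Q QF; case/Mz => [za|zb|[zR zQ]].
  - by rewrite /own (negPf (PR _ _ aP za)) (def_pblock tP aP za).
  - by rewrite /own (negPf (PR _ _ bP zb)) (def_pblock tP bP zb).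
  - by rewrite /own zR.
have sizeM Q : Q \in F -> s0 <= #|fM Q|.
  move=> QF; have [[ab aP bP aQ bQ] _ _ aM bM] := HM Q QF.
  have dab : [disjoint fa Q :\: Xs (fa Q) & fb Q :\: Xs (fb Q)].
    by apply: disjointW (subsetDl _ _) (subsetDl _ _) _; apply: (trivIsetP tP).
  have := subset_leq_card (introT subUsetP (conj aM bM)).
  have /eqP -> : #|(fa Q :\: Xs (fa Q)) :|: (fb Q :\: Xs (fb Q))| ==
      #|fa Q :\: Xs (fa Q)| + #|fb Q :\: Xs (fb Q)| by rewrite (leq_card_setU _ _).2.
  rewrite !cardsD !(setIidPr _) ?XsB // !szXs //.
  have [[_ sa] [_ sb]] := (Ps _ aP, Ps _ bP).
  have half m : m %/ K * 2 <= m.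
    by apply: leq_trans (leq_trunc_div m K); rewrite leq_mul2l K2 orbT.
  have arith t u v a b m : u * 2 <= a -> v * 2 <= b -> t <= a -> t <= b ->
    a - u + (b - v) <= m -> t <= m by clear; lia.
  exact: arith (half _) (half _) sa sb.
pose A := fa @: F :|: fb @: F.
have AP : A \subset P.
  by apply/subsetP => B /setUP[] /imsetP[Q /HM[[_ aP bP _ _] _ _ _ _] ->].
have injab : {in F &, injective fa} /\ {in F &, injective fb}.
  split=> Q Q' QF QF' E; have [[_ _ _ aQ bQ] _ _ _ _] := HM Q QF;
    have [[_ _ _ aQ' bQ'] _ _ _ _] := HM Q' QF'.
    by apply: (FF _ _ (inr (fa Q))) => //; rewrite E.
  by apply: (FF _ _ (inr (fb Q))) => //; rewrite E.
have cA : #|A| = 2 * #|F|.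
  have /eqP -> : #|A| == #|fa @: F| + #|fb @: F|.
    rewrite (leq_card_setU _ _).2 disjoint_subset; apply/subsetP => _ /imsetP[Q QF ->].
    rewrite inE; apply/imsetP => -[Q' QF' E].
    have [[ab _ _ aQ bQ] _ _ _ _] := HM Q QF; have [[_ _ _ aQ' bQ'] _ _ _ _] := HM Q' QF'.
    have QQ : Q = Q' by apply: (FF _ _ (inr (fa Q))) => //; rewrite E.
    by move: ab; rewrite E QQ eqxx.
  by rewrite !card_in_imset ?mul2n ?addnn //; case: injab.
pose P' := fM @: F :|: (P :\: A); exists P'.
have coverP' z : z \in cover P -> z \notin cover P' -> exists2 B, B \in P & z \in Xs B.
  case/bigcupP => B BP zB zP'; exists B => //; apply: contraT => zX.
  case/negP: zP'; have zBX : z \in B :\: Xs B by rewrite inE zX.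
  have [BA|BA] := boolP (B \in A); last first.
    by apply/bigcupP; exists B => //; rewrite in_setU in_setD BP BA orbT.
  case/setUP: BA => /imsetP[Q QF BE]; apply/bigcupP; exists (fM Q);
    rewrite ?inE ?imset_f //; have [_ _ _ aM bM] := HM Q QF.
    by apply: (subsetP aM); rewrite -BE.
  by apply: (subsetP bM); rewrite -BE.
split.
- split.
    apply: trivIsetU.
    + apply/trivIsetP => _ _ /imsetP[Q QF ->] /imsetP[Q' QF' ->] QQ'.
      rewrite disjoint_subset; apply/subsetP => z zQ; rewrite inE; apply: contra QQ' => zQ'.
      by rewrite (FF Q Q' (own z)) // ownM.
    + exact: trivIsetD.
    + rewrite disjoint_subset; apply/subsetP => z /bigcupP[_ /imsetP[Q QF ->] zM].
      rewrite inE; apply/bigcupP => -[B /setDP[BP BA] zB]; case/negP: BA.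
      have [[_ aP bP _ _] _ Mz _ _] := HM Q QF; case: (Mz z zM) => [za|zb|[zR _]].
      * by rewrite (PP B (fa Q) z) // in_setU imset_f.
      * by rewrite (PP B (fb Q) z) // in_setU (imset_f fb) ?orbT.
      * by have := PR B z BP zB; rewrite zR.
  move=> B /setUP[/imsetP[Q QF ->]|/setDP[/Ps //]].
  by split; [have [_ tr _ _ _] := HM Q QF | exact: sizeM].
- apply/bigcupsP => B /setUP[/imsetP[Q QF ->]|/setDP[BP _]]; last first.
    by apply: subset_trans (subsetUl _ _); apply: bigcup_sup.
  apply/subsetP => z; have [[_ aP bP _ _] _ Mz _ _] := HM Q QF; case/Mz => [za|zb|[zR _]].
  + by rewrite inE; apply/orP; left; apply/bigcupP; exists (fa Q).
  + by rewrite inE; apply/orP; left; apply/bigcupP; exists (fb Q).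
  + by rewrite inE zR orbT.
- have h1 : #|cover P| <= #|cover P'| + \sum_(B in P) #|Xs B|.
    rewrite -(cardsID (cover P') (cover P)); apply: leq_add.
      by apply/subset_leq_card/subsetIr.
    apply: leq_trans (card_bigcup_le _ _); apply/subset_leq_card/subsetP => z /setDP[zP zP'].
    by have [B BP zB] := coverP' z zP zP'; apply/bigcupP; exists B.
  have h2 : K * (\sum_(B in P) #|Xs B|) <= #|V|.
    apply: (@leq_trans #|cover P|); last exact: max_card.
    rewrite -(eqP tP) big_distrr /= leq_sum // => B BP.
    by rewrite szXs // mulnC leq_trunc_div.
  by apply: leq_trans (leq_mul (leqnn K) h1) _; rewrite mulnDr leq_add2l.
- move=> P0; have [F0|F0] := posnP #|F|.
    have A0 : A = set0 by apply/eqP; rewrite -cards_eq0 cA F0.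
    by apply: leq_trans P0 _; rewrite /P' A0 setD0; apply/subset_leq_card/subsetUr.
  have /card_gt0P[Q QF] := F0; apply/card_gt0P; exists (fM Q).
  by rewrite inE imset_f.
- have arith f p p' : p' <= f + (p - 2 * f) -> 2 * f <= p -> p <= 5 * f + 1 ->
    5 * p'.-1 <= 4 * p.-1 by clear; lia.
  apply: (arith #|F|) => //; last by rewrite -cA subset_leq_card.
  apply: leq_trans (leq_card_setU _ _) _; apply: leq_add; first exact: leq_imset_card.
  by rewrite cardsD (setIidPr AP) cA.
Qed.

Lemma rev_link x q y : path e x (rcons q y) -> path e y (rcons (rev q) x).
Proof.
move=> xqy; have := rev_path e x (rcons q y).
rewrite last_rcons belast_rcons rev_cons => ->.
by rewrite (eq_path (e' := e)) // => u v; rewrite e_sym.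
Qed.

(** The last path is closed by a junction between its two end segments. *)
Lemma close_path (R1 R2 B : {set V}) :
  linked e R1 R2 -> (forall S : {set V}, #|trapped e R1 S| <= X * #|S|) ->
  K * X.+1 <= #|B| -> traceable B -> [disjoint B & R1 :|: R2] ->
  exists c, [/\ cycle e c, uniq c & #|B| <= size c + 2 * (#|B| %/ K)].
Proof.
move=> lk bd KB /traceableP[p pB] dB; have [sp up BE] := pB; have szp := traces_size pB.
have [m mE] : exists m, m = #|B| %/ K by exists (#|B| %/ K).
have m2 : 2 * m <= size p.
  rewrite mE szp mulnC; apply: leq_trans (leq_trunc_div #|B| K); by rewrite leq_mul2l K2 orbT.
pose Xs (b : bool) := if b then [set z in take m p] else [set z in drop (size p - m) p].
have idrop z : z \in drop (size p - m) p -> size p - m <= index z p.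
  move=> zd; have zp := mem_drop zd; rewrite leqNgt -in_take //.
  move: up; rewrite -{1}(cat_take_drop (size p - m) p) cat_uniq => /and3P[_ /hasPn/(_ z zd)].
  by [].
have itake z : z \in take m p -> index z p < m.
  by move=> zt; rewrite -in_take // (mem_take zt).
have XsP b : Xs b \subset B.
  by rewrite BE; apply/subsetP => z; case: b; rewrite !inE; [apply: mem_take | apply: mem_drop].
have dX : [disjoint Xs true & Xs false].
  rewrite disjoint_subset; apply/subsetP => z; rewrite !inE => /itake zm.
  apply/negP => /idrop; lia.
have szX b : #|Xs b| = m.
  case: b; rewrite cardsE.
    have /card_uniqP -> : uniq (take m p) by rewrite take_uniq.
    by rewrite size_takel //; lia.
  have /card_uniqP -> : uniq (drop (size p - m) p) by rewrite drop_uniq.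
  by rewrite size_drop; lia.
have [|||F [tF F2 Fl]] := links e_sym lk bd (A := [set: bool]) (Xs := Xs).
- by move=> [] [] // _ _ _; rewrite disjoint_sym.
- by move=> b _; rewrite szX mE leq_divRL ?(ltnW K2) // mulnC.
- by move=> b _; apply: disjointWl (XsP b) dB.
have /card_gt0P[Q /Fl] : 0 < #|F| by move: F2; rewrite cardsT card_bool; case: #|F|.
move=> [a [b [x [y [q [[ab _ _ _ _] xa yb [uq pq] qR]]]]]].
(* orient the junction from the initial to the final segment *)
have {a b ab xa yb Q qR uq pq} [x1 [y1 [q1 [xX yX uq pq qR]]]] :
  exists x y q, [/\ x \in Xs true, y \in Xs false, uniq q, path e x (rcons q y) &
    {in q, forall z, z \in R1 :|: R2}].
  case: a b ab xa yb => [] [] // _ xa yb.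
    by exists x, y, q; split=> // z /qR[].
  exists y, x, (rev q); split=> //; rewrite ?rev_uniq //; first exact: rev_link.
  by move=> z; rewrite mem_rev => /qR[].
move: xX yX; rewrite !inE => xX yX; have xi := itake _ xX; have yi := idrop _ yX.
have xp := mem_take xX; have yp := mem_drop yX.
have jp : index y1 p < size p by rewrite index_mem.
have iE := nth_index x1 xp; have jE := nth_index x1 yp.
move: (index x1 p) (index y1 p) xi yi jp iE jE => i j xi yi jp iE jE.
have ij : i < j by move: xi yi m2; clear; lia.
have [s sdef] : exists s, s = drop i (take j.+1 p) by exists (drop i (take j.+1 p)).
have szs : size s = j.+1 - i by rewrite sdef size_drop size_takel.
have ss : sorted e s by rewrite sdef; apply/drop_sorted/take_sorted.
have us : uniq s by rewrite sdef drop_uniq // take_uniq.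
have sp' z : z \in s -> z \in p by rewrite sdef => /mem_drop/mem_take.
have nths k : k < size s -> nth x1 s k = nth x1 p (i + k).
  by rewrite szs => ks; rewrite sdef nth_drop nth_take //; move: ks; clear; lia.
have [t sE] : exists t, s = x1 :: t.
  have := nths 0; case: s szs {sdef ss us sp' nths} => [|z t] /=; first by move: ij; clear; lia.
  by move=> _ /(_ isT); rewrite addn0 iE => ->; exists t.
have lt : last x1 t = y1.
  have -> : last x1 t = nth x1 s (size s).-1 by rewrite nth_last sE.
  rewrite nths ?szs; last by move: ij; clear; lia.
  have -> : i + (j.+1 - i).-1 = j by move: ij; clear; lia.
  exact: jE.
exists (s ++ rev q1); split.
- rewrite sE /= rcons_cat cat_path lt rev_link // andbT.
  by move: ss; rewrite sE.
- rewrite cat_uniq us rev_uniq uq andbT /=; apply/hasPn => z /=; rewrite mem_rev => zq.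
  apply/negP => /sp' zp; have /pred0P/(_ z) := dB; rewrite /= qR // andbT.
  by rewrite BE inE zp.
- rewrite size_cat szs size_rev -szp szp -mE -szp; move: xi yi m2 jp ij; clear; lia.
Qed.

End Merging.

(** * Path covers and the long cycle *)

Section Cover.
Variables (V : finType) (e : rel V).
Hypothesis e_sym : symmetric e.
Variables (T : nat).
Hypothesis toughT : label_tough e T.
Hypothesis TV : T <= #|V|.

(** In a partition into as few paths as possible, the first vertices of the paths
    are independent, because two paths with adjacent first vertices can be joined. *)
Lemma path_cover (U : {set V}) : exists P : {set {set V}},
  [/\ trivIset P, cover P = U, {in P, forall B, traceable e B} & T * #|P| <= #|V|].
Proof.
pose good (P : {set {set V}}) :=
  [&& trivIset P, cover P == U & [forall B in P, traceable e B && (B != set0)]].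
have g0 : good [set [set x] | x in U].
  apply/and3P; split.
  - apply/trivIsetP => _ _ /imsetP[x _ ->] /imsetP[y _ ->] xy.
    by rewrite disjoints1 inE; apply: contra xy => /eqP->.
  - apply/eqP/setP => z; apply/bigcupP/idP => [[_ /imsetP[x xU ->] /set1P->] //|zU].
    by exists [set z]; rewrite ?imset_f ?set11.
  - apply/forall_inP => _ /imsetP[x _ ->]; apply/andP; split.
      apply/traceableP; exists [:: x]; split=> //; apply/setP => z; by rewrite !inE.
    by apply/set0Pn; exists x; rewrite set11.
case: (@arg_minnP _ _ good (fun P : {set {set V}} => #|P|) g0) => P gP Pmin.
have [tP /eqP cP /forall_inP bP] := and3P gP.
exists P; split=> //; first by move=> B /bP/andP[].
have [->|P0] := eqVneq P set0; first by rewrite cards0 muln0.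
have /fin_all_exists[pth pthP] : forall B : {set V}, exists p : V * seq V,
    B \in P -> traces e B (p.1 :: p.2).
  move=> B; have [/bP/andP[/traceableP[[|x p] pB] B0]|_] := boolP (B \in P).
  - case: pB => _ _ BE; case/set0Pn: B0 => z; rewrite BE inE //.
  - by exists (x, p).
  - have /set0Pn[B' /bP/andP[_ /set0Pn[x _]]] := P0; by exists (x, [::]).
pose hd B := (pth B).1.
have hdB B : B \in P -> hd B \in B.
  by move=> BP; have [_ _ BE] := pthP B BP; rewrite [in X in _ \in X]BE inE /hd inE eqxx.
have PP B B' z : B \in P -> B' \in P -> z \in B -> z \in B' -> B = B'.
  exact: trivIset_eq tP.
have injhd : {in P &, injective hd}.
  by move=> B B' BP BP' E; apply: (PP _ _ (hd B)) => //; rewrite ?hdB // E hdB.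
pose Z := hd @: P.
have cZ : #|Z| = #|P| by rewrite card_in_imset.
have iZ : indep e Z.
  apply/indepP => _ _ /imsetP[B BP ->] /imsetP[B' BP' ->] hh; congr (hd _).
  apply/eqP; apply: contraT => BB'.
  have [s1 u1 BE] := pthP B BP; have [s2 u2 BE'] := pthP B' BP'.
  have tBB : traceable e (B :|: B').
    apply/traceableP; exists (rev (hd B' :: (pth B').2) ++ (hd B :: (pth B).2)); split.
    - rewrite rev_cons cat_rcons.
      have : sorted e (rcons (rev (pth B').2) (hd B')).
        by rewrite -rev_cons rev_sorted (eq_sorted (e' := e)) // => u v; rewrite e_sym.
      rewrite -cat_rcons; case: (rev _) => [|z t] /=; first by rewrite e_sym hh.
      by move=> pt; rewrite cat_path last_rcons pt /= e_sym hh.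
    - rewrite cat_uniq rev_uniq u1 u2 andbT andTb; apply/hasPn => z zB; apply/negP => zr.
      have : z \in rev (hd B' :: (pth B').2) by [].
      rewrite mem_rev => zB'; case/eqP: BB'; apply: (PP _ _ z) => //.
        by rewrite BE inE.
      by rewrite BE' inE.
    - by apply/setP => z; rewrite in_setU [in LHS]BE [in LHS]BE' !inE mem_cat mem_rev !inE orbC.
  pose P' := (B :|: B') |: (P :\ B :\ B').
  have cPP : cover (P :\ B :\ B') = cover P :\: B :\: B'.
    rewrite coverD1 ?coverD1 //; first exact: trivIsetD.
    by rewrite !inE eq_sym BB'.
  have /Pmin : good P'.
    apply/and3P; split.
    - apply: trivIsetU; rewrite ?trivIset1 //; first exact/trivIsetD/trivIsetD.
      rewrite cover1 cPP disjoint_subset; apply/subsetP => z; rewrite !inE.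
      by case/orP => ->; rewrite //= andbF.
    - rewrite /P' /cover bigcup_setU big_set1 -/(cover _) cPP -cP; apply/eqP/setP => z.
      have sB : z \in B -> z \in cover P by move=> zB; apply/bigcupP; exists B.
      have sB' : z \in B' -> z \in cover P by move=> zB; apply/bigcupP; exists B'.
      rewrite !inE; case: (z \in B) sB => [->|_] //; case: (z \in B') sB' => [->|_] //.
    - apply/forall_inP => C /setU1P[->|]; last by rewrite !inE => /and3P[_ _ /bP].
      by rewrite tBB; apply/set0Pn; exists (hd B); rewrite inE hdB.
  rewrite leqNgt => /negP; case.
  have PBB : P = B |: (B' |: (P :\ B :\ B')).
    by rewrite setD1K ?setD1K // !inE eq_sym BB'.
  rewrite [in X in _ < X]PBB; apply: leq_ltn_trans (leq_card_setU _ _) _.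
  by rewrite cards1 !cardsU1 !inE !eqxx (negPf BB') /= !add1n.
have Z0 : Z != set0 by rewrite -card_gt0 cZ card_gt0.
rewrite -cZ; apply: leq_trans (indep_nbh e_sym toughT TV Z0 iZ) _.
exact: max_card.
Qed.
End Cover.

Section Assembly.
Variables (V : finType) (e : rel V).
Hypothesis e_sym : symmetric e.

Lemma merge_rounds (X K s0 L : nat) (R1 R2 : nat -> {set V}) (P : {set {set V}}) :
  1 < K -> 0 < s0 -> K * X.+1 <= s0 ->
  (forall r, r < L -> linked e (R1 r) (R2 r)) ->
  (forall r, r < L -> forall S : {set V}, #|trapped e (R1 r) S| <= X * #|S|) ->
  pathsys e s0 P -> 0 < #|P| ->
  (forall r, r <= L -> [disjoint cover P & R1 r :|: R2 r]) ->
  (forall r r', r < r' -> r' <= L -> [disjoint R1 r :|: R2 r & R1 r' :|: R2 r']) ->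
  forall i, i <= L -> exists P',
    [/\ pathsys e s0 P', 0 < #|P'|, K * #|cover P| <= K * #|cover P'| + i * #|V|,
        5 ^ i * #|P'|.-1 <= 4 ^ i * #|P|.-1 &
        forall r, i <= r -> r <= L -> [disjoint cover P' & R1 r :|: R2 r]].
Proof.
move=> K2 s00 Ks lk bd ps P0 dP dR; elim=> [_|i IH iL].
  by exists P; split=> //; rewrite ?mul1n ?addn0 // => r _; apply: dP.
have [P1 [ps1 P10 c1 e1 d1]] := IH (ltnW iL).
have [P2 [ps2 s2 c2 p2 e2]] := merge_round e_sym K2 (lk i iL) (bd i iL) s00 Ks ps1 (d1 i (leqnn i) (ltnW iL)).
exists P2; split=> //.
- exact: p2.
- rewrite mulSn; move: c1 c2; clear; lia.
- rewrite !expnS; apply: (@leq_trans (5 ^ i * (4 * #|P1|.-1))).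
    by rewrite mulnAC mulnC leq_mul2l e2 orbT.
  by rewrite mulnCA -mulnA leq_mul2l e1 orbT.
- move=> r ir rL; rewrite disjoint_sym; apply: disjointWr s2 _.
  rewrite disjoint_sym disjoint_subset; apply/subsetP => z; rewrite inE => /orP[zP|zR]; rewrite inE.
    have := d1 r (ltnW ir) rL; rewrite disjoint_subset => /subsetP/(_ z zP).
    by rewrite inE.
  by have := dR i r ir rL; rewrite disjoint_subset => /subsetP/(_ z zR); rewrite inE.
Qed.

Lemma pigeonhole (D : nat) (h : V -> 'I_D) : 0 < D ->
  exists b, D * #|[set v | h v == b]| <= #|V|.
Proof.
move=> D0; have [b bP|nb] := pickP (fun b => D * #|[set v | h v == b]| <= #|V|).
  by exists b.
have : D * #|V|.+1 <= \sum_(b : 'I_D) D * #|[set v | h v == b]|.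
  rewrite -[X in X * _]card_ord -sum_nat_const leq_sum // => b _.
  by rewrite ltnNge nb.
rewrite -big_distrr /= leq_pmul2l //.
have -> : \sum_(b : 'I_D) #|[set v | h v == b]| = #|V|.
  rewrite -[RHS]sum1_card (partition_big h predT) //=.
  by apply: eq_bigr => b _; rewrite sum1dep_card.
by rewrite ltnn.
Qed.

(** The vertices lost are those of the reserves, of the short paths, and of the
    ends cut off during the L rounds and the closing: at most n / D for the first
    (the lightest of D blocks of colours is taken), n / D for the second, and
    (L + 2) n / K = n / D for the third. *)
Lemma long_cycle_param (D l L X Y K s0 Th T : nat) (C := ('I_D * ('I_L.+1 * bool))%type) :
  3 < D -> 1 < l -> #|V| < 2 ^ l -> T <= #|V| -> label_tough e T ->
  4 ^ L * #|V| < 5 ^ L -> K = D * L.+2 -> s0 = K * X.+1 -> D * s0 <= T ->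
  4 * Th <= T -> X.+1 <= 2 * Th -> #|{: C}| ^ 2 * (10 * l) <= Th ->
  #|{: C}| * (5 * l) <= Y -> 2 * Y < X -> Y < T -> #|{: C}| <= 2 ^ l -> 3 * D <= T ->
  exists c, [/\ cycle e c, uniq c, 2 < size c & D * #|V| <= D * size c + 3 * #|V|].
Proof.
move=> D3 l1 nl TV tT L54 KE s0E Ds0 ThT XTh CTh CY YX YT Cl DT.
have D0 : 0 < D by apply: leq_trans D3.
have C0 : 0 < #|{: C}| by rewrite /C !card_prod !card_ord card_bool !muln_gt0 D0.
have [f [bd lk]] := good_colouring e_sym tT nl ThT XTh CTh C0 (ltnW l1) CY YX YT TV Cl l1.
have [b bn] := pigeonhole (fun v => (f v).1) D0.
set Rb := [set v | (f v).1 == b] in bn.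
(* the r-th reserve in the block b consists of the two classes Rc true r, Rc false r *)
pose Rc (c : bool) (r : nat) := colour_class f ((b, (inord r, c)) : C).
have RcP c r z : z \in Rc c r -> (f z).1 = b /\ (f z).2.1 = inord r.
  by rewrite inE => /eqP->.
have RP r z : z \in Rc true r :|: Rc false r -> (f z).1 = b /\ (f z).2.1 = inord r.
  by case/setUP; apply: RcP.
have [P0 [tP0 cP0 trP0 TP0]] := path_cover e_sym tT TV (~: Rb).
pose P := [set B in P0 | s0 <= #|B|].
have PP0 : P \subset P0 by apply/subsetP => B; rewrite inE => /andP[].
have psP : pathsys e s0 P.
  split; first exact: trivIsetS PP0 tP0.
  by move=> B; rewrite inE => /andP[/trP0].
have K1 : 1 < K by rewrite KE; case: (D) D3 => // D' _; rewrite mulSn; lia.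
have s00 : 0 < s0 by rewrite s0E muln_gt0 (ltnW K1).
have Ks : K * X.+1 <= s0 by rewrite s0E.
have U_P : #|~: Rb| <= #|cover P| + s0 * #|P0|.
  rewrite -cP0 -(eqP tP0) -(eqP psP.1) (bigID (fun B : {set V} => s0 <= #|B|)) /=.
  apply: leq_add; first by apply: eq_leq; apply: eq_bigl => B; rewrite inE.
  apply: (@leq_trans (\sum_(B in P0) s0)); last by rewrite sum_nat_const mulnC.
  rewrite big_mkcond [leqRHS]big_mkcond leq_sum //= => B _.
  by case: (B \in P0) => //=; case: (leqP s0 #|B|) => //= /ltnW.
have URb : #|Rb| + #|~: Rb| = #|V| by rewrite cardsC.
have coverP : D * #|V| <= D * #|cover P| + 2 * #|V|.
  have h1 : D * s0 * #|P0| <= #|V| by apply: leq_trans TP0; rewrite leq_mul2r Ds0 orbT.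
  have h2 : D * #|~: Rb| <= D * (#|cover P| + s0 * #|P0|) by rewrite leq_mul2l U_P orbT.
  move: h1 h2 bn; rewrite -URb; clear; rewrite !mulnDr !mulnA; lia.
have n0 : 0 < #|V| by apply: leq_trans TV; apply: leq_trans DT; rewrite muln_gt0.
have P_gt0 : 0 < #|P|.
  rewrite card_gt0; apply/eqP => PE; move: coverP; rewrite PE /cover big_set0 cards0 muln0 add0n.
  by rewrite leq_pmul2r // leqNgt (leq_trans _ D3).
have dP r : r <= L -> [disjoint cover P & Rc true r :|: Rc false r].
  move=> _; rewrite disjoint_subset; apply/subsetP => z /bigcupP[B BP zB].
  rewrite inE; apply/negP => /RP[zb _].
  have : z \in cover P0 by apply/bigcupP; exists B => //; apply: (subsetP PP0).
  by rewrite cP0 !inE zb eqxx.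
have dR r r' : r < r' -> r' <= L -> [disjoint Rc true r :|: Rc false r & Rc true r' :|: Rc false r'].
  move=> rr rL; rewrite disjoint_subset; apply/subsetP => z /RP[_ z1]; rewrite inE.
  apply/negP => /RP[_]; rewrite z1 => /(congr1 val) /=.
  rewrite !inordK ?ltnS // ?(leq_trans (ltnW rr)) // => E.
  by rewrite E ltnn in rr.
have lkr r : r < L.+1 -> linked e (Rc true r) (Rc false r).
  by move=> _; apply: lk; apply/eqP => -[].
have bdr r : r < L.+1 -> forall S : {set V}, #|trapped e (Rc true r) S| <= X * #|S|.
  by move=> _ S; apply: bd.
have [P' [psP' P'0 cP' eP' dP']] := merge_rounds K1 s00 Ks (fun r rL => lkr r (ltnW rL))
  (fun r rL => bdr r (ltnW rL)) psP P_gt0 dP dR (leqnn L).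
have P'1 : #|P'| == 1.
  have Pn : #|P| <= #|V|.
    apply: leq_trans (max_card (mem (cover P))); rewrite -(eqP psP.1) -sum1_card.
    by apply: leq_sum => B BP; have [_] := psP.2 B BP; apply: leq_trans.
  rewrite eqn_leq P'0 andbT leqNgt; apply/negP => P2.
  have : 5 ^ L <= 4 ^ L * #|V|.
    apply: (leq_trans _ (leq_trans eP' _)).
      by rewrite leq_pmulr // -subn1 subn_gt0.
    by rewrite leq_mul2l (leq_trans (leq_pred _) Pn) orbT.
  by rewrite leqNgt L54.
have [B PE] := cards1P P'1; have cB : cover P' = B by rewrite PE cover1.
have [trB sB] : traceable e B /\ s0 <= #|B| by apply: psP'.2; rewrite PE set11.
have dB : [disjoint B & Rc true L :|: Rc false L] by rewrite -cB; apply: dP'.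
have [c [cyc uc sc]] := close_path e_sym K1 (lkr L (leqnn _)) (bdr L (leqnn _)) (leq_trans Ks sB) trB dB.
have key : D * #|V| <= D * size c + 3 * #|V|.
  have hB : K * (#|B| %/ K) <= #|V| by rewrite mulnC (leq_trans (leq_trunc_div _ _)) // max_card.
  have h1 : K * #|B| <= K * (size c + 2 * (#|B| %/ K)) by rewrite leq_mul2l sc orbT.
  have h2 : K * #|cover P| <= K * size c + L.+2 * #|V|.
    move: cP' h1 hB; rewrite cB; clear; rewrite mulnDr; nia.
  have h3 : D * #|cover P| <= D * size c + #|V|.
    rewrite -(leq_pmul2l (m := L.+2)) //; move: h2; rewrite KE; clear; nia.
  move: coverP h3; clear; lia.
exists c; split=> //.
have : 0 < D * (size c) by move: key D3 n0; clear; nia.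
rewrite ltnNge; have := leq_trans DT TV; move: key D3; clear => key D3 Dn sc0; apply/negP => sc2.
nia.
Qed.

(** The choice of the parameters: L = 4 l rounds suffice since (5/4)^4 > 2, and with
    2 D (4 l + 1) colours all the conditions amount to T being a large multiple of
    (D l)^3. *)
Theorem long_cycle (D l : nat) (T := 5000 * D ^ 3 * l ^ 3) :
  3 < D -> 1 < l -> #|V| < 2 ^ l -> T <= #|V| -> label_tough e T ->
  exists c, [/\ cycle e c, uniq c, 2 < size c & D * #|V| <= D * size c + 3 * #|V|].
Proof.
move=> D4 l2 nl TV tT.
pose q := 2 * D * (4 * l + 1).
have cC : #|{: ('I_D * ('I_(4 * l).+1 * bool))}| = q.
  by rewrite !card_prod !card_ord card_bool /q; clear; lia.
have q10 : q <= 10 * (D * l) by rewrite /q; move: l2; clear; nia.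
have q0 : 0 < q by rewrite /q; move: D4 l2; clear; nia.
pose Y := 5 * l * q; pose X := (2 * Y).+1; pose Th := 10 * l * q ^ 2.
pose K := D * (4 * l).+2.
have TE : T = 5000 * (D * l) ^ 3 by rewrite /T expnMn mulnA.
set m := D * l in TE q10.
have lm : l <= m by rewrite /m leq_pmull // (ltn_trans _ D4).
have Dm : D <= m by rewrite /m leq_pmulr // (ltn_trans _ l2).
have m0 : 0 < m by rewrite (leq_trans _ Dm) // (ltn_trans _ D4).
have mm : m <= m ^ 3 by rewrite -[leqLHS]expn1 leq_pexp2l.
have m2 : m ^ 2 <= m ^ 3 by rewrite leq_pexp2l.
have Yb : Y <= 50 * m ^ 2.
  rewrite /Y -mulnn; apply: leq_trans (_ : 5 * m * (10 * m) <= _); last by clear; lia.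
  by rewrite leq_mul // leq_mul2l.
have lq0 : 0 < l * q by rewrite muln_gt0 q0 (ltn_trans _ l2).
have Xb : X.+1 <= 12 * (l * q) by rewrite /X /Y -mulnA; move: lq0; clear; lia.
have Kb : K <= 5 * m by rewrite /K /m; move: l2; clear; nia.
apply: (@long_cycle_param D l (4 * l) X Y K (K * X.+1) Th T) => //; rewrite ?cC //.
- rewrite !expnM; apply: (@leq_trans ((4 ^ 4) ^ l * 2 ^ l)).
    by rewrite ltn_pmul2l ?expn_gt0.
  by rewrite -expnMn leq_exp2r // (ltn_trans _ l2).
- apply: (@leq_trans (D * (5 * m * (12 * (l * q))))); first by rewrite leq_mul2l leq_mul ?orbT.
  have -> : D * (5 * m * (12 * (l * q))) = 60 * (m * m) * q by rewrite /m; clear; lia.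
  apply: (@leq_trans (60 * (m * m) * (10 * m))); first by rewrite leq_mul2l q10 orbT.
  by rewrite TE !expnS expn0; clear; nia.
- have qq : q ^ 2 <= (10 * m) ^ 2 by rewrite leq_exp2r.
  apply: (@leq_trans (4 * (10 * m * (10 * m) ^ 2))).
    by rewrite /Th leq_mul2l leq_mul // leq_mul2l lm orbT.
  by rewrite TE !expnS expn0; clear; nia.
- apply: leq_trans Xb _; rewrite /Th expnS expn1; move: lq0 q0; clear; nia.
- by rewrite /Th mulnC.
- by rewrite /Y mulnC.
- by apply: leq_ltn_trans Yb _; rewrite TE; move: m2 m0; clear => m2 m0; nia.
- apply: leq_trans (ltnW nl); apply: leq_trans TV; rewrite TE.
  by apply: leq_trans q10 _; move: mm; clear; lia.
- by rewrite TE; move: mm Dm; clear; lia.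
Qed.

End Assembly.

(** * The asymptotic statement *)

Lemma cube_le_exp (a k : nat) : 256 * a <= k -> a * k.+1 ^ 3 <= 2 ^ k.
Proof.
move=> ak; (* k + 1 is at most 4 (k %/ 4 + 1), and m < 2 ^ m *)
pose m := k %/ 4; have km : k.+1 <= 4 * 2 ^ m.
  have : m < 2 ^ m by apply: ltn_expl.
  by have := ltn_ceil k (isT : 0 < 4); rewrite -/m; lia.
have k4 : 2 ^ (4 * m) <= 2 ^ k by rewrite leq_exp2l // mulnC leq_trunc_div.
apply: leq_trans k4; apply: (@leq_trans (a * (4 * 2 ^ m) ^ 3)).
  by rewrite leq_mul2l leq_exp2r // km orbT.
have am : 64 * a <= 2 ^ m.
  have : m < 2 ^ m by apply: ltn_expl.
  have : 64 * a <= m by rewrite leq_divRL //; lia.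
  lia.
rewrite expnMn -expnM mulnA (_ : 4 * m = m + m * 3); last by lia.
by rewrite expnD leq_mul2r; apply/orP; right; lia.
Qed.

Import all_order all_algebra all_classical all_reals all_analysis.
Import Order.TTheory GRing.Theory Num.Theory.
Import numFieldNormedType.Exports.

Local Open Scope classical_set_scope.
Local Open Scope ring_scope.

(** Representatives of the labels lie in distinct components. *)
Lemma tough_label (R : realType) (t : R) (V : finType) (e : rel V) (T : nat) :
  symmetric e -> T%:R <= t -> tough t e -> label_tough e T.
Proof.
move=> e_sym Tt te k W lab k1 labE labO.
have dsym : connect_sym (graph_del e W).
  by apply: sym_connect_sym => x y; rewrite /graph_del /= e_sym; congr (_ && _); exact: andbC.
have labC x y : connect (graph_del e W) x y -> lab x = lab y.
  case/connectP => p + ->; elim: p x => //= z p IH x /andP[/and3P[xz xW zW] /IH <-].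
  exact: labE.
have kn : (k <= num_components_del e W)%N.
  have /fin_all_exists[r rP] : forall c, exists x,
      [&& x \in fingraph.roots (graph_del e W), x \in ~: W & lab x == c].
    move=> c; have [x xW <-] := labO c; exists (fingraph.root (graph_del e W) x).
    have cx := connect_root (graph_del e W) x.
    have /connectP[p pP pE] : connect (graph_del e W) (fingraph.root (graph_del e W) x) x.
      by rewrite dsym.
    apply/and3P; split; [exact: (roots_root dsym x) | | by rewrite (labC _ _ cx)].
    by case: p pP pE => [_ /= <-|y p /= /andP[/and3P[_ rW _] _] _]; rewrite inE.
  have rinj : injective r.
    by move=> c d E; have /and3P[_ _ /eqP <-] := rP c; rewrite E; have /and3P[_ _ /eqP] := rP d.
  rewrite -[k]card_ord -(card_imset _ rinj); apply: subset_leq_card.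
  apply/fintype.subsetP => _ /imsetP[c _ ->]; have /and3P[r1 r2 _] := rP c.
  by rewrite inE; apply/andP; split.
have := te W (leq_trans k1 kn); rewrite -(ler_nat R) natrM => h.
apply: le_trans h; apply: ler_pM => //; by rewrite ler_nat.
Qed.

Theorem theorem1p7 (R : realType) (t : nat -> R)
    (ht : t n / ln n%:R ^+ 3 @[n --> \oo] --> +oo) (delta : R)
    (hdelta : 0 < delta) :
  \forall n \near \oo, forall (V : finType) (e : rel V),
    simple_graph e -> #|V| = n -> tough (t n) e ->
    exists c : seq V, graph_cycle e c /\ (1 - delta) * n%:R <= (size c)%:R.
Proof.
pose D := (Num.bound (3 / delta)).+4.
have D3 : 3 <= delta * D%:R.
  have : 3 / delta < (Num.bound (3 / delta))%:R by apply: archi_boundP; rewrite divr_ge0 // ltW.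
  rewrite ltr_pdivrMr // mulrC => /ltW /le_trans; apply.
  by rewrite ler_pM2l // ler_nat /D; lia.
have ln2 : 0 < ln (2 : R) by rewrite ln_gt0 // ltr1n.
(* 2 ^ k0 is large enough for T <= n below, by [cube_le_exp] *)
pose k0 := (256 * (5000 * D ^ 3)).+1%N.
have near_t := (cvgryPge _).1 ht ((5000 * D ^ 3)%N%:R * (2 / ln 2) ^+ 3).
near=> n => V e [e_sym _] Vn te.
have tn : (5000 * D ^ 3)%N%:R * (2 / ln 2) ^+ 3 <= t n / ln n%:R ^+ 3 by near: n; exact: near_t.
have nk : (2 ^ k0 <= n)%N by near: n; exact: nbhs_infty_ge.
pose k := trunc_log 2 n; pose l := k.+1.
have n0 : (0 < n)%N by apply: (leq_trans _ nk); rewrite expn_gt0.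
have /andP[kn nl] := trunc_log_bounds (isT : (1 < 2)%N) n0.
have k0k : (k0 <= k)%N by rewrite /k -(trunc_expnK k0 (isT : (1 < 2)%N)) leq_trunc_log.
have Tn : (5000 * D ^ 3 * l ^ 3 <= n)%N.
  by apply: leq_trans kn; apply: cube_le_exp; apply: leq_trans k0k; apply: leqnSn.
have k_gt0 : (0 < k)%N by apply: leq_trans k0k.
have lnn : 0 < ln (n%:R : R).
  rewrite ln_gt0 // ltr1n; apply: leq_trans kn.
  by apply: (@leq_trans (2 ^ 1)%N); rewrite // leq_exp2l.
have ln_l : l%:R <= 2 / ln 2 * ln (n%:R : R).
  apply: (@le_trans _ _ (2 * k%:R)).
    by rewrite -natrM ler_nat /l; move: k_gt0; clear; lia.
  rewrite -mulrA ler_pM2l // mulrC ler_pdivlMr // mulr_natl.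
  rewrite -lnXn ?ltr0n // ler_ln ?posrE ?exprn_gt0 ?ltr0n //.
  by rewrite -natrX ler_nat.
have Tt : (5000 * D ^ 3 * l ^ 3)%N%:R <= t n.
  move: tn; rewrite ler_pdivlMr ?exprn_gt0 // => /(le_trans _); apply.
  rewrite natrM -mulrA -exprMn ler_wpM2l ?ler0n // natrX.
  by rewrite lerXn2r // nnegrE ?ler0n // mulr_ge0 ?divr_ge0 ?ltW.
have [|||||c [cyc uc c3 sc]] := @long_cycle V e e_sym D l.
- by [].
- by rewrite /l; move: k_gt0; clear; lia.
- by rewrite Vn.
- by rewrite Vn.
- exact: tough_label e_sym Tt te.
exists c; split; first by split; [apply/andP; split | ].
move: sc; rewrite Vn -(ler_nat R) natrD !natrM => sc.
have D0 : 0 < D%:R :> R by rewrite ltr0n.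
rewrite -(ler_pM2l D0) mulrBl mul1r mulrBr lerBlDr; apply: le_trans sc _.
by rewrite lerD2l mulrA ler_wpM2r ?ler0n // mulrC.
Unshelve. all: by end_near. Qed.
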